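(* Let $m\ge 2$ be an integer, $a>0$, $\theta>1$, $\sigma>1$ real numbers, and let $Q$, $q$, $b_1,\dots,b_{m-1}$, $h$ be as in the context; in particular $$(-1)^m Q(r,t_0,\ldots,t_{m-1})\ \ge\ q(r)h(t_0)-\sum_{i=1}^{m-1}b_i(r)|t_i|$$ whenever $r\ge a$, $t_0>0$ and $(-1)^i t_i\ge 0$ for $i=1,\ldots,m-1$. Let $g$, $f$ be the functions defined in the context. Suppose that $$\int_0^1 g^{-1/m}(t)\,t^{1/m-1}\,dt<\infty,\qquad \int_a^\infty \xi^{m-1} f(\xi)\,d\xi<\infty,$$ and, moreover, $$L:=\limsup_{r\to\infty}\frac{r^m f(r)}{\int_r^\infty\xi^{m-1}f(\xi)\,d\xi}<\infty .$$ Then any regular solution $w$ of the problem $$w^{(m)}=Q(r,w,\ldots,w^{(m-1)}),\quad r\ge a,\qquad (-1)^i w^{(i)}(r)\ge 0,\quad r\ge a,\ i=0,\ldots,m-1,$$ satisfies the estimate $$w(r)\ge G_\infty^{-1}\left(C\left(\int_r^\infty\xi^{m-1}f(\xi)\,d\xi\right)^{1/m}\right)$$ for all sufficiently large $r$, where $G_\infty^{-1}$ is the function inverse to $$G_\infty(\xi)=\int_0^\xi g^{-1/m}(t)\,t^{1/m-1}\,dt,$$ and the constant $C>0$ depends only on $m$, $\theta$, $\sigma$ and $L$.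
   Context: Setting. $Q:[a,\infty)\times\mathbb R^m\to\mathbb R$ belongs to the Caratheodory class $K_{loc}([a,\infty)\times\mathbb R^m)$: $Q(\cdot,t)$ is measurable for every $t\in\mathbb R^m$, $Q(r,\cdot)$ is continuous for almost every $r$, and for every $\rho>0$ the function $r\mapsto\sup_{|t|\le\rho}|Q(r,t)|$ is integrable on every compact subinterval of $[a,\infty)$. The functions $q:[a,\infty)\to[0,\infty)$ and $b_i:[a,\infty)\to[0,\infty)$, $i=1,\ldots,m-1$, belong to $L_{\infty,loc}([a,\infty))$ (measurable and essentially bounded on compact subintervals), and $h:(0,\infty)\to(0,\infty)$ is continuous. Solutions. A function $w:[a,\infty)\to\mathbb R$ is a solution of the problem if $w^{(i)}$, $i=0,\ldots,m-1$, are locally absolutely continuous on $[a,\infty)$, the equation holds for almost all $r\in[a,\infty)$, and the sign conditions hold for all $r\in[a,\infty)$. A solution is non-trivial if it is not identically zero on $[a,\infty)$. A non-trivial solution is regular if it does not vanish identically in any neighborhood of infinity. Notation. For the fixed (arbitrarily chosen) real numbers $\theta>1$, $\sigma>1$: $$g(t)=\inf_{(t/\theta,\,\theta t)}h,\quad t\in(0,\infty),$$ $$f(r)=\frac{q(r)}{1+\sum_{i=1}^{m-1}r^{m-i}\,\operatorname{ess\,sup}_{(r/\sigma,\,r\sigma)\cap[a,\infty)}b_i},\quad r\in[a,\infty).$$ The function $G_\infty$ is considered for $\xi\in[0,\infty)$; it is strictly increasing there with $G_\infty(0)=0$. *)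

(* Defs.v *)
From HB Require Import structures.
From mathcomp Require Import all_boot all_order all_algebra.
From mathcomp Require Import all_classical all_reals all_analysis.

Set Implicit Arguments.
Unset Strict Implicit.
Unset Printing Implicit Defensive.

Import Order.TTheory GRing.Theory Num.Theory.
Import numFieldNormedType.Exports.

Local Open Scope classical_set_scope.
Local Open Scope ring_scope.

(* MathComp-Analysis' lebesgue_measure lives on the Borel sigma-algebra.  We use
   the completed measure, so that "measurable" is Lebesgue measurability;
   lebesgue_line R is R with the sigma-algebra of Lebesgue measurable sets. *)
Definition lebesgue_line (R : realType) :=
  caratheodory_type ((@wlength R idfun)^*)%mu.

Notation leb := completed_lebesgue_measure.

Definition lebesgue_measurable_fun (R : realType) (D : set R) (u : R -> R) :=
  @measurable_fun _ _ (lebesgue_line R) R D u.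

Definition ess_sup_on (R : realType) (D : set R) (u : R -> R) : \bar R :=
  ereal_inf [set y | \forall x \ae leb, D x -> ((u x)%:E <= y)%E].

Definition Linfty_loc (R : realType) (a : R) (u : R -> R) :=
  lebesgue_measurable_fun `[a, +oo[ u /\
  forall c d, a <= c -> (ess_sup_on `[c, d] (fun x => `|u x|%R) < +oo)%E.

Definition euclidean_norm (R : realType) (m : nat) (t : 'rV[R]_m) : R :=
  Num.sqrt (\sum_(i < m) t ord0 i ^+ 2).

Definition Kloc (R : realType) (m : nat) (a : R) (Q : R -> 'rV[R]_m -> R) :=
  [/\ forall t, lebesgue_measurable_fun `[a, +oo[ (fun r => Q r t),
      \forall r \ae leb, a <= r -> continuous (Q r)
    & forall rho : R, 0 < rho -> forall c d, a <= c ->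
        leb.-integrable `[c, d] (fun r : lebesgue_line R =>
          ereal_sup [set `|Q r t|%:E | t in
                      [set t | euclidean_norm t <= rho]])].

Definition abs_continuous (R : realType) (c d : R) (u : R -> R) :=
  forall e : R, 0 < e -> exists2 delta : R, 0 < delta &
    forall (n : nat) (x y : 'I_n -> R),
      (forall i, [/\ c <= x i, x i <= y i & y i <= d]) ->
      trivIset [set: 'I_n] (fun i => `]x i, y i[%classic) ->
      \sum_(i < n) (y i - x i) < delta ->
      \sum_(i < n) `|u (y i) - u (x i)| < e.

Definition loc_abs_continuous (R : realType) (a : R) (u : R -> R) :=
  forall c d, a <= c -> abs_continuous c d u.

(* Derivatives of functions on [a, oo[: the difference quotient is restricted to
   [a, oo[, so that the derivative at a is the one-sided one, and the values of
   the function on ]-oo, a[ are irrelevant. *)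
Definition diff_quotient (R : realType) (u : R -> R) (x y : R) : R :=
  (u y - u x) / (y - x).

Definition derivable_from (R : realType) (a : R) (u : R -> R) (x : R) :=
  cvg (diff_quotient u x y @[y --> within `[a, +oo[ x^']).

Definition derive_from (R : realType) (a : R) (u : R -> R) (x : R) : R :=
  lim (diff_quotient u x y @[y --> within `[a, +oo[ x^']).

Definition deriven_from (R : realType) (a : R) (n : nat) (u : R -> R) :=
  iter n (derive_from a) u.

Definition is_solution (R : realType) (m : nat) (a : R)
    (Q : R -> 'rV[R]_m -> R) (w : R -> R) :=
  [/\ forall i r, (i.+1 < m)%N -> a <= r ->
        derivable_from a (deriven_from a i w) r,
      forall i, (i < m)%N -> loc_abs_continuous a (deriven_from a i w),
      \forall r \ae leb, a <= r ->
        derivable_from a (deriven_from a m.-1 w) r /\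
        deriven_from a m w r = Q r (\row_(i < m) deriven_from a i w r)
    & forall i r, (i < m)%N -> a <= r -> 0 <= (-1) ^+ i * deriven_from a i w r].

Definition nontrivial (R : realType) (a : R) (w : R -> R) :=
  exists2 r, a <= r & w r != 0.

Definition is_regular (R : realType) (a : R) (w : R -> R) :=
  nontrivial a w /\ forall r0, a <= r0 -> exists2 r, r0 <= r & w r != 0.

Definition g_fun (R : realType) (theta : R) (h : R -> R) (t : R) : R :=
  inf [set h x | x in `]t / theta, theta * t[].

(* The essential supremum is finite when b i is in L_{oo,loc} and nonnegative on
   [a, oo[, so fine loses nothing; b 0 is not used. *)
Definition f_fun (R : realType) (m : nat) (sigma a : R) (q : R -> R)
    (b : nat -> R -> R) (r : R) : R :=
  q r / (1 + \sum_(1 <= i < m) r ^+ (m - i) *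
    fine (ess_sup_on (`]r / sigma, r * sigma[ `&` `[a, +oo[) (b i))).

Definition G_integrand (R : realType) (m : nat) (g : R -> R) (t : R) : R :=
  g t `^ (- m%:R^-1) * t `^ (m%:R^-1 - 1).

Definition G_infty (R : realType) (m : nat) (g : R -> R) (xi : R) : R :=
  fine (\int[leb]_(t in `]0%R, xi[) (G_integrand m g t)%:E)%E.

(* G_infty may be bounded, so its inverse is only meaningful on its range
   G_infty @` [0, oo[; outside of it, this function is 0. *)
Definition G_infty_inv (R : realType) (m : nat) (g : R -> R) : R -> R :=
  'pinv_(fun=> 0) `[0, +oo[ (G_infty m g).

Definition tail (R : realType) (m : nat) (f : R -> R) (r : R) : \bar R :=
  (\int[leb]_(xi in `[r, +oo[) (xi ^+ m.-1 * f xi)%:E)%E.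

(* If the tail vanishes at some r, the quotient there is x / 0 = 0; then
   G_infty_inv (C * 0) = 0, so no positivity of the tail has to be assumed. *)
Definition limsup_quotient (R : realType) (m : nat) (f : R -> R) : \bar R :=
  limf_esup (fun r : R => (r ^+ m * f r / fine (tail m f r))%:E) +oo.

(* Main.v *)
Require Import Defs.
From mathcomp Require Import all_boot all_order all_algebra.
From mathcomp Require Import all_classical all_reals all_analysis.
From mathcomp Require Import measurable_realfun ring lra.

(** Put [u_i := (-1)^i w^(i) >= 0] and let [T(r)] be the tail integral of
[xi^(m-1) f(xi)].  On an interval [[s, s']] with [s' <= min(sigma, 2) s] the
Taylor sums of the [u_i] at [s], suitably weighted, form a locally absolutely
continuous function whose derivative is at most
[- D f(x) inf h(w) (x - s)^(m-1) / (m-1)!] and which decreases by at most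
[D (w(s) - w(s'))], where [D >= 1] is such that [D f <= q]; integrating gives
[w(s) - w(s') >= c inf h(w) (eta / s)^(m-1) (T(s + eta) - T(s'))].
The limsup condition bounds [T(s) - T(s + eta)] by [eta L' T(s) / s], and with
[eta] of order [s (T(s) - T(s')) / T(s)] the previous inequality becomes
[(w / inf h)^(1/m) >= c (T(rho)^(1/m) - T(rho')^(1/m))] as long as
[w(rho') >= w(rho) / sqrt theta].  On such a stretch the left-hand side is
at most a multiple of [G(w(rho)) - G(w(rho) / sqrt theta)]; summing over
consecutive stretches and letting [rho'] tend to infinity yields
[G(w(rho)) >= C T(rho)^(1/m)]. *)

Set Implicit Arguments.
Unset Strict Implicit.
Unset Printing Implicit Defensive.

Import Order.TTheory GRing.Theory Num.Theory.
Import numFieldNormedType.Exports.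
Import HBNNSimple.

Local Open Scope classical_set_scope.
Local Open Scope ring_scope.

(** * Absolutely continuous functions with a one-sided derivative bound *)

(** The weight [(x - s)^(m-1)] coming from the Taylor sums vanishes at [s], whereas the tail carries
    [xi^(m-1)]. The two are comparable only away from [s]: on [[s + eta, s']] one has
    [x - s >= eta x / (2 s)]. The limsup condition keeps too much of the tail from lying in the
    discarded piece [[s, s + eta]], and the choice of [eta] balances the two losses. The factor [D]
    depends on the sizes of the [b_i] on [[s, s']], but it multiplies both sides of the integral
    inequality and cancels; this is why the constant does not see the [b_i], and why [f] has the
    denominator it has. The derivative of order [m - 1] is only absolutely continuous, so the
    estimates cannot come from a mean value argument; they rest on one-sided bounds for increments
    that are allowed to fail on a null set. The number of stretches is finite because a regular
    solution stays positive and loses the factor [sqrt theta] on each complete one. *)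

Lemma real_induction (R : realType) (c d : R) (P : R -> Prop) :
  c <= d -> P c ->
  (forall x, c <= x -> x < d -> P x -> exists y, [/\ x < y, y <= d & P y]) ->
  (forall x, c < x -> x <= d ->
     (forall e, 0 < e -> exists y, [/\ x - e < y, y < x, c <= y & P y]) ->
     P x) ->
  P d.
Proof.
move=> cd Pc Pr Pl; pose S := [set x | [/\ c <= x, x <= d & P x]].
have Sc : S c by split.
have Sub : has_ubound S by exists d => x [].
have hS : has_sup S by split => //; exists c.
have cs : c <= sup S by exact: ub_le_sup.
have sd : sup S <= d by apply: ge_sup; [exists c | move=> x []].
have Ps : P (sup S).
  have [//|nPs] := pselect (P (sup S)).
  move: cs; rewrite le_eqVlt => /predU1P[<- //|cs].
  apply: Pl => // e e0.
  have [y [cy yd Py] ey] := sup_adherent e0 hS.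
  exists y; split=> //; rewrite lt_neqAle ub_le_sup ?andbT//.
  by apply/eqP => yE; apply: nPs; rewrite -yE.
move: sd; rewrite le_eqVlt => /predU1P[<- //|sd].
have [y [sy yd Py]] := Pr _ cs sd Ps.
have : y <= sup S by apply: ub_le_sup => //; split=> //; exact: le_trans (ltW sy).
by rewrite leNgt sy.
Qed.

(** An upper slope in the sense of the straddle lemma: the increments are taken over intervals that
    contain [x]. Such bounds add up, and they make sense where no derivative exists, for instance
    for the primitive of an indicator function. *)
Definition straddle_le (R : realType) (v : R -> R) (x l : R) :=
  forall e, 0 < e -> exists2 eta, 0 < eta & forall y z,
    x - eta < y -> y <= x -> x <= z -> z < x + eta ->
    v z - v y <= (l + e) * (z - y).

Lemma open_ballW (R : realType) (U : set R) x : open U -> U x ->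
  exists2 eta, 0 < eta & forall y, x - eta < y < x + eta -> U y.
Proof.
move=> oU Ux; have : nbhs x U by exact: open_nbhs_nbhs.
rewrite -nbhs_ballE => -[eta /= eta0 eU].
exists eta => // y xy; apply: eU.
by rewrite /ball/= ltr_norml; apply/andP; split; lra.
Qed.

Lemma sum_disjoint_itv_le (R : realType) (U : set R) (n : nat) (X Y : nat -> R) :
  measurable U -> (forall i, (i < n)%N -> X i <= Y i) ->
  (forall i, (i < n)%N -> `]X i, Y i[%classic `<=` U) ->
  trivIset `I_n (fun i => `]X i, Y i[%classic) ->
  ((\sum_(i < n) (Y i - X i))%:E <= lebesgue_measure U)%E.
Proof.
move=> mU XY sU tI.
pose F i := if (i < n)%N then `]X i, Y i[%classic else set0.
have mF i : measurable (F i) by rewrite /F; case: ifP.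
have tF : trivIset setT F.
  move=> i j _ _; rewrite /F; case: ifPn => ni; case: ifPn => nj; last 3 first.
  - by case=> x [].
  - by case=> x [].
  - by case=> x [].
  by apply: tI.
rewrite -sumEFin.
have -> : (\sum_(i < n) (Y i - X i)%:E = \sum_(i < n) lebesgue_measure (F i))%E.
  apply: eq_bigr => i _; rewrite /F ltn_ord lebesgue_measure_itv/= lte_fin.
  by case: ltP => // /(conj (XY _ (ltn_ord i)))/andP/le_anti ->; rewrite subrr.
rewrite -measure_bigsetU//; apply: le_measure.
- rewrite inE; apply: bigsetU_measurable => k _; exact: mF.
- by rewrite inE.
- apply: (big_ind (fun A : set R => A `<=` U)) => //; first by move=> A B AU BU x [/AU|/BU].
  by move=> i _; rewrite /F ltn_ord; exact: sU.
Qed.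

(** A null set of the completed measure sits in a set of outer measure 0, to which outer regularity
    applies. *)
Lemma leb_negligible_open (R : realType) (N : set R) (e : R) :
  leb.-negligible (N : set (lebesgue_line R)) -> 0 < e ->
  exists U : set R, [/\ open U, N `<=` U & (lebesgue_measure U <= e%:E)%E].
Proof.
move=> [A [/= mA A0 NA]] e0.
have [U [oU AU Ue]] := outer_measure_open_le A e0.
exists U; split => //; first exact: subset_trans NA AU.
have A0' : ((wlength idfun)^*%mu A = 0)%E by exact: A0.
by rewrite A0' add0e in Ue.
Qed.

(* The null set [N] is covered by an open set of small measure, on which absolute
   continuity controls the increments; elsewhere the local bound does. *)
Lemma abs_continuous_nonincreasing (R : realType) (c d : R) (v : R -> R)
    (N : set R) :
  c <= d -> abs_continuous c d v ->
  leb.-negligible (N : set (lebesgue_line R)) ->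
  (forall x, c < x -> x < d -> ~ N x -> straddle_le v x 0) ->
  v d <= v c.
Proof.
move=> cd acv negN hv; apply/ler_addgt0Pr => e e0.
(* The slopes cost at most [e' * (d - c)] altogether, and the intervals inside [U] one further
   [e']. *)
pose e' := e / (d - c + 1).
have dc1 : 0 < d - c + 1 by lra.
have e'0 : 0 < e' by rewrite divr_gt0.
have [delta delta0 acd] := acv _ e'0.
(* The endpoints, about which [hv] says nothing, are added to the null set. The value [delta / 2]
   leaves room for the strict inequality required by absolute continuity. *)
have [||U [oU NU Ud]] := @leb_negligible_open R (N `|` [set c; d]) (delta / 2).
- apply: negligibleU => //; apply: negligibleU.
    exists [set c]; split => //=; first exact: sub_caratheodory (measurable_set1 c).
    exact: lebesgue_measure_set1.
  exists [set d]; split => //=; first exact: sub_caratheodory (measurable_set1 d).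
  exact: lebesgue_measure_set1.
- by rewrite divr_gt0.
have Uc : U c by apply: NU; right; left.
have UdE : U d by apply: NU; right; right.
(* A certificate that [x] has been reached from [c]: finitely many ordered intervals inside [U]
   account for whatever the slope [e'] does not. *)
pose good x n (X Y : nat -> R) := 
  [/\ forall i, (i < n)%N -> [/\ c <= X i, X i <= Y i & Y i <= x],
      forall i, (i < n)%N -> `]X i, Y i[%classic `<=` U,
      forall i j, (i < j)%N -> (j < n)%N -> Y i <= X j &
      v x - v c <= e' * (x - c) + \sum_(i < n) `|v (Y i) - v (X i)|].
pose P x := exists n X Y, good x n X Y.
have stepU y z : c <= y -> y <= z -> `]y, z[%classic `<=` U -> P y -> P z.
  move=> cy yz yzU [n [X [Y [h1 h2 h3 h4]]]].
  exists n.+1, (fun i => if (i < n)%N then X i else y),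
    (fun i => if (i < n)%N then Y i else z); split.
  - move=> i _; case: ifPn => [/h1[? ? ?]|_]; split => //; first exact: le_trans yz.
  - by move=> i _; case: ifPn => [/h2|_].
  - move=> i j ij; rewrite ltnS => jn; rewrite (leq_trans ij jn).
    case: ifPn => [|_]; first exact: h3.
    by have [] := h1 _ (leq_trans ij jn).
  - rewrite big_ord_recr/= ltnn; under eq_bigr do rewrite ltn_ord.
    have := ler_norm (v z - v y).
    have : e' * (y - c) <= e' * (z - c) by rewrite ler_pM2l//; lra.
    lra.
have stepN y z : y <= z -> v z - v y <= e' * (z - y) -> P y -> P z.
  move=> yz vzy [n [X [Y [h1 h2 h3 h4]]]]; exists n, X, Y; split => //.
    by move=> i /h1[? ? ?]; split => //; exact: le_trans yz.
  have -> : e' * (z - c) = e' * (y - c) + e' * (z - y) by ring.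
  lra.
(* Real induction plays the role of compactness: a point of [U] is passed by appending one interval
   to the certificate, any other point by the slope bound. *)
have Pd : P d.
  apply: (@real_induction R c d P cd).
  - exists 0%N, (fun=> 0), (fun=> 0); split => //.
    by rewrite big_ord0 !subrr mulr0 addr0.
  - move=> x cx xd Px; have [Ux|nUx] := pselect (U x).
      have [eta eta0 etaU] := open_ballW oU Ux.
      exists (Num.min (x + eta / 2) d).
      have [? ?] : Num.min (x + eta / 2) d <= x + eta / 2 /\ x < Num.min (x + eta / 2) d.
        by rewrite lt_min ge_min lexx xd; split => //; rewrite andbT; lra.
      split => //; first by rewrite ge_min lexx orbT.
      apply: (stepU x) => //; first exact: ltW.
      by move=> y /=; rewrite in_itv/= => /andP[? ?]; apply: etaU; apply/andP; split; lra.
    have cx' : c < x by rewrite lt_neqAle cx andbT; apply/eqP => cE; apply: nUx; rewrite -cE.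
    have nNx : ~ N x by move=> Nx; apply: nUx; apply: NU; left.
    have [eta eta0 heta] := hv _ cx' xd nNx _ e'0.
    exists (Num.min (x + eta / 2) d).
    have [? ?] : Num.min (x + eta / 2) d <= x + eta / 2 /\ x < Num.min (x + eta / 2) d.
      by rewrite lt_min ge_min lexx xd; split => //; rewrite andbT; lra.
    split => //; first by rewrite ge_min lexx orbT.
    apply: (stepN x) => //; first exact: ltW.
    by rewrite -[e' in leRHS]add0r; apply: heta => //; lra.
  - move=> x cx xd hx; have [Ux|nUx] := pselect (U x).
      have [eta eta0 etaU] := open_ballW oU Ux.
      have [y [xy yx cy Py]] := hx _ eta0.
      apply: (stepU y) => //; first exact: ltW.
      by move=> z /=; rewrite in_itv/= => /andP[? ?]; apply: etaU; apply/andP; split; lra.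
    have xd' : x < d by rewrite lt_neqAle xd andbT; apply/eqP => cE; apply: nUx; rewrite cE.
    have nNx : ~ N x by move=> Nx; apply: nUx; apply: NU; left.
    have [eta eta0 heta] := hv _ cx xd' nNx _ e'0.
    have [y [xy yx cy Py]] := hx _ eta0.
    apply: (stepN y) => //; first exact: ltW.
    by rewrite -[e' in leRHS]add0r; apply: heta => //; lra.
have [n [X [Y [h1 h2 h3 h4]]]] := Pd.
have tI : trivIset `I_n (fun i => `]X i, Y i[%classic).
  apply/trivIsetP => i j /= ni nj.
  wlog: i j ni nj / (i < j)%N.
    move=> h; rewrite neq_ltn => /orP[|] ij; first by apply: h => //; rewrite neq_ltn ij.
    by rewrite setIC; apply: h => //; rewrite neq_ltn ij.
  move=> ij _; apply/seteqP; split => // z [] /=; rewrite !in_itv/=.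
  by move=> /andP[_ ?] /andP[? _]; have := h3 _ _ ij nj; lra.
have sumlt : \sum_(i < n) (Y i - X i) < delta.
  have h1' i : (i < n)%N -> X i <= Y i by move=> /h1[].
  have := sum_disjoint_itv_le (open_measurable oU) h1' h2 tI.
  move=> /le_trans/(_ Ud); rewrite lee_fin; lra.
have := acd n (fun i => X i) (fun i => Y i).
move=> /(_ _ _ sumlt) H.
have {}H : \sum_(i < n) `|v (Y i) - v (X i)| < e'.
  apply: H; first by move=> i; apply: h1.
  move=> i j _ _ XY; apply/val_inj; apply: tI => //=.
have : e' * (d - c + 1) = e by rewrite /e' divfK// gt_eqF.
by rewrite mulrDr mulr1; lra.
Qed.

Lemma straddle_le_trans (R : realType) (v : R -> R) x l l' :
  l <= l' -> straddle_le v x l -> straddle_le v x l'.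
Proof.
move=> ll' h e e0; have [eta eta0 H] := h _ e0; exists eta => // y z *.
apply: le_trans (H y z _ _ _ _) _ => //; apply: ler_wpM2r; lra.
Qed.

Lemma straddle_leD (R : realType) (v v' : R -> R) x l l' :
  straddle_le v x l -> straddle_le v' x l' ->
  straddle_le (fun y => v y + v' y) x (l + l').
Proof.
move=> h h' e e0; have e20 : 0 < e / 2 by lra.
have [eta eta0 H] := h _ e20; have [eta' eta'0 H'] := h' _ e20.
have m0 : 0 < Num.min eta eta' by rewrite lt_min eta0.
have [m1 m2] : Num.min eta eta' <= eta /\ Num.min eta eta' <= eta'.
  by rewrite !ge_min !lexx orbT.
exists (Num.min eta eta') => // y z ? ? ? ?.
have {}H : v z - v y <= (l + e / 2) * (z - y) by apply: H => //; lra.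
have {}H' : v' z - v' y <= (l' + e / 2) * (z - y) by apply: H' => //; lra.
have -> : (l + l' + e) * (z - y) = (l + e / 2) * (z - y) + (l' + e / 2) * (z - y).
  by field.
lra.
Qed.

Lemma straddle_leZ (R : realType) (v : R -> R) x l r : 0 <= r ->
  straddle_le v x l -> straddle_le (fun y => r * v y) x (r * l).
Proof.
move=> r0 h e e0; have r10 : 0 < r + 1 by lra.
have [eta eta0 H] := h (e / (r + 1)) (divr_gt0 e0 r10).
exists eta => // y z ? ? ? ?.
have {H} : v z - v y <= (l + e / (r + 1)) * (z - y) by apply: H.
move=> /(ler_wpM2l r0); rewrite mulrBr => /le_trans; apply.
rewrite mulrA; apply: ler_wpM2r; first lra.
rewrite mulrDr lerD2l mulrCA ler_piMr ?(ltW e0)// ler_pdivrMr//; lra.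
Qed.

Lemma straddle_le_sum (R : realType) (I : eqType) (s : seq I) (v : I -> R -> R)
    (l : I -> R) x : (forall i, i \in s -> straddle_le (v i) x (l i)) ->
  straddle_le (fun y => \sum_(i <- s) v i y) x (\sum_(i <- s) l i).
Proof.
elim: s => [_|i s IH h].
  rewrite big_nil => e e0; exists 1 => // y z *.
  by rewrite !big_nil subrr mulr_ge0//; lra.
rewrite big_cons; under eq_fun do rewrite big_cons.
apply: straddle_leD; first by apply: h; rewrite mem_head.
by apply: IH => j js; apply: h; rewrite in_cons js orbT.
Qed.

Lemma abs_continuousD (R : realType) (c d : R) (u v : R -> R) :
  abs_continuous c d u -> abs_continuous c d v ->
  abs_continuous c d (fun x => u x + v x).
Proof.
move=> hu hv e e0; have e20 : 0 < e / 2 by lra.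
have [du du0 Hu] := hu _ e20; have [dv dv0 Hv] := hv _ e20.
exists (Num.min du dv); first by rewrite lt_min du0.
move=> n x y xy tI; rewrite lt_min => /andP[lu lv].
have := Hu n x y xy tI lu; have := Hv n x y xy tI lv.
have : \sum_(i < n) `|u (y i) + v (y i) - (u (x i) + v (x i))| <=
    \sum_(i < n) (`|u (y i) - u (x i)| + `|v (y i) - v (x i)|).
  apply: ler_sum => i _; apply: le_trans (ler_normD _ _).
  by rewrite le_eqVlt; apply/orP; left; apply/eqP; congr `|_|; ring.
rewrite big_split/=; lra.
Qed.

Lemma lipschitz_abs_continuous (R : realType) (c d k : R) (u : R -> R) :
  (forall x y, c <= x -> x <= y -> y <= d -> `|u y - u x| <= k * (y - x)) ->
  abs_continuous c d u.
Proof.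
move=> h e e0; have k0 : 0 < `|k| + 1 by rewrite ltr_wpDl.
exists (e / (`|k| + 1)); first by rewrite divr_gt0.
move=> n x y xy _; rewrite ltr_pdivlMr// mulr_suml; apply: le_lt_trans.
apply: ler_sum => i _; have [? ? ?] := xy i.
apply: le_trans (h _ _ _ _ _) _ => //; rewrite mulrC ler_wpM2l ?subr_ge0//.
by have := ler_norm k; lra.
Qed.

(** * Inner approximation and primitives of indicator functions *)

(** Outer regularity for the complement of [A] in [[c, d]] gives an open [U], and the closed set is
    [[c, d]] minus [U]. Everything has finite measure, so the measure of that complement can be
    added to both sides. *)
Lemma lebesgue_inner_closed (R : realType) (c d e : R) (A : set (lebesgue_line R)) :
  measurable A -> A `<=` `[c, d] -> 0 < e ->
  exists K : set R, [/\ closed K, K `<=` A & (leb A <= lebesgue_measure K + e%:E)%E].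
Proof.
move=> mA Acd e0; have mcd : measurable (`[c, d] : set (lebesgue_line R)).
  exact: sub_caratheodory (measurable_itv _).
have [U [oU BU Ue]] := outer_measure_open_le (`[c, d] `\` A) e0.
have mU : measurable (U : set (lebesgue_line R)).
  exact: sub_caratheodory (open_measurable oU).
have cK : closed (`[c, d] `&` ~` U).
  by apply: closedI; [exact: itv_closed|rewrite closedC].
have mK : measurable (`[c, d] `&` ~` U : set (lebesgue_line R)).
  exact: measurableI mcd (measurableC mU).
exists (`[c, d] `&` ~` U); split => //.
  by move=> x [xcd nUx]; apply: contrapT => nAx; apply: nUx; apply: BU.
have mB : measurable (`[c, d] `\` A : set (lebesgue_line R)) by exact: measurableD.
have fcd : (leb (`[c, d] : set (lebesgue_line R)) < +oo)%E.
  have -> : leb (`[c, d] : set (lebesgue_line R)) = lebesgue_measure `[c, d] by [].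
  by rewrite lebesgue_measure_itv; case: ifP => _; rewrite ?ltry.
have fB : (leb (`[c, d] `\` A : set (lebesgue_line R)) \is a fin_num).
  rewrite ge0_fin_numE//; apply: le_lt_trans fcd; apply: le_measure.
  - by rewrite inE.
  - by rewrite inE.
  - exact: subIsetl.
rewrite -(leeD2rE _ _ fB) -measureU//; last by rewrite setDE setICA setICr setI0.
have -> : A `|` `[c, d] `\` A = `[c, d]%classic :> set R.
  by rewrite setDE setUIr setUCr setIT; exact/setUidr.
apply: (@le_trans _ _ (leb ((`[c, d] `&` ~` U) `|` U : set (lebesgue_line R)))).
  apply: le_measure; [by rewrite inE|by rewrite inE; exact: measurableU|].
  by move=> x cdx; have [?|?] := pselect (U x); [right|left].
apply: (@le_trans _ _ (leb (`[c, d] `&` ~` U : set (lebesgue_line R)) + leb (U : set (lebesgue_line R)))%E).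
  exact: measureU2.
rewrite -addeA; apply: leeD2l; rewrite addeC; exact: Ue.
Qed.

Lemma lebesgue_itv_fin_num (R : realType) (c d : R) (A : set R) :
  measurable A -> A `<=` `[c, d] -> lebesgue_measure A \is a fin_num.
Proof.
move=> mA Acd; rewrite ge0_fin_numE//.
apply: (@le_lt_trans _ _ (lebesgue_measure `[c, d]%classic)).
  by apply: le_measure => //; rewrite inE.
by rewrite lebesgue_measure_itv; case: ifP => _; rewrite ?ltry.
Qed.

(** The primitive of the indicator function of [K], written so that its increments are measures of
    pieces of [K]. *)
Definition cumulated (R : realType) (c : R) (K : set R) (x : R) : R :=
  fine (lebesgue_measure (K `&` `[c, x])).

Lemma cumulatedB (R : realType) (c x y : R) (K : set R) :
  measurable K -> c <= x -> x <= y ->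
  cumulated c K y - cumulated c K x = fine (lebesgue_measure (K `&` `]x, y])).
Proof.
move=> mK cx xy; rewrite /cumulated.
have -> : K `&` `[c, y] = (K `&` `[c, x]) `|` (K `&` `]x, y]).
  rewrite -setIUr; congr (_ `&` _); apply/seteqP; split => z /=; rewrite !in_itv/=.
    by move=> /andP[-> zy]; case: (leP z x) => zx; [left|right].
  by case=> /andP[? ?]; apply/andP; split; lra.
rewrite measureU; [| exact: measurableI | exact: measurableI |].
  rewrite fineD; first by ring.
  - by apply: (@lebesgue_itv_fin_num _ c x) => //; exact: measurableI.
  - apply: (@lebesgue_itv_fin_num _ x y); first exact: measurableI.
    by move=> z [_] /=; rewrite !in_itv/= => /andP[/ltW -> ->].
apply/seteqP; split => // z [[_ /=]]; rewrite in_itv/= => /andP[_ zx] [_ /=].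
by rewrite in_itv/= ltNge zx.
Qed.

Lemma cumulatedB_itv (R : realType) (c x y : R) (K : set R) :
  measurable K -> c <= x -> x <= y ->
  0 <= cumulated c K y - cumulated c K x <= y - x.
Proof.
move=> mK cx xy; rewrite cumulatedB// fine_ge0//=.
rewrite -lee_fin fineK; last first.
  apply: (@lebesgue_itv_fin_num _ x y); first exact: measurableI.
  by move=> z [_] /=; rewrite !in_itv/= => /andP[/ltW -> ->].
apply: (@le_trans _ _ (lebesgue_measure `]x, y]%classic)).
  by apply: le_measure; rewrite ?inE//; exact: measurableI.
rewrite lebesgue_measure_itv/= lte_fin; case: ifP => // _.
by rewrite lee_fin subr_ge0.
Qed.

(** Closedness makes the bound valid at every point: off [K] a whole neighbourhood misses [K] and
    the function is locally constant, and on [K] the trivial slope 1 suffices. *)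
Lemma cumulated_straddle (R : realType) (c x : R) (K : set R) : closed K ->
  c < x -> straddle_le (cumulated c K) x (x \in K)%:R.
Proof.
move=> cK cx e e0; have mK : measurable K by exact: closed_measurable.
have [xK|xK] := boolP (x \in K).
  exists (x - c); first by rewrite subr_gt0.
  move=> y z *; have [| |_] := andP (@cumulatedB_itv R c y z K mK _ _); [lra|lra|].
  rewrite (_ : true%:R = 1 :> R)//.
  by move/le_trans; apply; rewrite ler_peMl//; lra.
have [||eta eta0 H] := @open_ballW _ (~` K) x; first exact: closed_openC.
  by move: xK; rewrite notin_setE.
exists (Num.min eta (x - c)); first by rewrite lt_min eta0 subr_gt0.
have [m1 m2] : Num.min eta (x - c) <= eta /\ Num.min eta (x - c) <= x - c.
  by rewrite !ge_min !lexx orbT.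
move=> y z yx1 yx2 xz1 xz2; rewrite cumulatedB; [|by []|lra|lra].
suff -> : K `&` `]y, z] = set0 by rewrite measure0/= add0r mulr_ge0//; lra.
apply/seteqP; split => // t [Kt] /=; rewrite in_itv/= => /andP[yt tz].
by apply: (H t) => //; apply/andP; split; lra.
Qed.

(* The level sets of a simple function below [phi] are shrunk to closed sets: it
   becomes upper semicontinuous, so that its primitive [F] satisfies
   [straddle_le] everywhere and no differentiation theorem is needed. *)
Lemma abs_continuous_integral_le (R : realType) (c d : R) (u phi : R -> R)
    (N : set R) :
  c <= d -> abs_continuous c d u -> (forall x, c <= x -> x <= d -> 0 <= phi x) ->
  leb.-negligible (N : set (lebesgue_line R)) ->
  (forall x, c < x -> x < d -> ~ N x -> straddle_le u x (- phi x)) ->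
  (\int[leb]_(x in (`[c, d] : set (lebesgue_line R))) (phi x)%:E <= (u c - u d)%:E)%E.
Proof.
move=> cd acu phi0 negN hu; rewrite ge0_integralE; last first.
  by move=> x /=; rewrite in_itv/= lee_fin => /andP[? ?]; exact: phi0.
apply: ge_ereal_sup => _ [s /= sphi <-]; rewrite sintegralE.
have fs : finite_set (range s) by exact: fimfunP.
rewrite fsbig_finite//=.
set S := finmap.enum_fset _.
have SP r : (r \in S) = (r \in range s) by rewrite /S in_fset_set.
have uS : uniq S by rewrite /S finmap.fset_uniq.
have S0 r : r \in S -> 0 <= r by rewrite SP inE => -[x _ <-].
have sSin x : s x \in S by rewrite SP inE; exists x.
apply/lee_addgt0Pr => e e0.
(* Replacing the level set of [r] by a closed subset costs [e'] in measure, weighted by [r]; the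
   [+ 1] covers a zero sum. *)
pose e' := e / (\sum_(r <- S) r + 1).
have sS : 0 <= \sum_(r <- S) r by rewrite big_seq sumr_ge0.
have e'0 : 0 < e' by rewrite divr_gt0//; lra.
(* Positive level sets of [s] lie in [[c, d]], since the restricted integrand is 0 elsewhere. The
   remaining levels carry no weight and get the dummy [set0]. *)
have hK r : exists K : set R, closed K /\ (0 < r ->
    [/\ K `<=` s @^-1` [set r] , K `<=` `[c, d] & (leb (s @^-1` [set r]) <= lebesgue_measure K + e'%:E)%E]).
  have [r0|r0] := leP r 0; first by exists set0; split => //; exact: closed0.
  have Acd : s @^-1` [set r] `<=` `[c, d].
    move=> x /= sx; apply: contrapT => xcd; have := sphi x.
    by rewrite patchE memNset// sx lee_fin leNgt r0.
  have mA : measurable (s @^-1` [set r]) by exact: measurable_funPTI.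
  have [K [cK KA Ke]] := lebesgue_inner_closed mA Acd e'0.
  by exists K; split => // _; split => //; exact: subset_trans KA Acd.
have [K {}hK] := choice hK.
have mK r : measurable (K r) by apply: closed_measurable; case: (hK r).
pose F x := \sum_(r <- S) r * cumulated c (K r) x.
have acF : abs_continuous c d F.
  apply: (@lipschitz_abs_continuous _ c d (\sum_(r <- S) r)) => x y cx xy yd.
  rewrite /F -sumrB mulr_suml; apply: le_trans (ler_norm_sum _ _ _) _.
  rewrite big_seq [leRHS]big_seq; apply: ler_sum => r rS.
  have /andP[F0 F1] := @cumulatedB_itv R c x y (K r) (mK r) cx xy.
  rewrite -mulrBr normrM (ger0_norm F0) (ger0_norm (S0 _ rS)).
  by apply: ler_wpM2l => //; exact: S0.
have := abs_continuous_nonincreasing cd (abs_continuousD acu acF) negN.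
have hv x : c < x -> x < d -> ~ N x -> straddle_le (fun y => u y + F y) x 0.
  move=> cx xd nNx.
  (* At most the set [K (s x)] contains [x], so the upper slope of [F] at [x] is at most [s x],
     hence at most [phi x]. *)
  apply: (@straddle_le_trans _ _ _ (- phi x + \sum_(r <- S) r * (x \in K r)%:R)).
    rewrite addrC subr_le0.
    have /(_ x) := sphi; rewrite patchE mem_set/= ?in_itv/= ?(ltW cx) ?(ltW xd)// lee_fin.
    apply: le_trans; rewrite [leRHS](_ : _ = \sum_(r <- S) r * (r == s x)%:R).
      rewrite big_seq [leRHS]big_seq; apply: ler_sum => r rS.
      have := S0 _ rS; rewrite le_eqVlt => /predU1P[<-|r0]; first by rewrite !mul0r.
      apply: ler_wpM2l; first exact: ltW.
      have [_ /(_ r0) [KA _ _]] := hK r.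
      have [xK|] := boolP (x \in K r); last by [].
      by have /= -> := KA _ (set_mem xK); rewrite eqxx.
    rewrite (bigD1_seq (s x))//= eqxx mulr1 big1 ?addr0// => r /negbTE ->.
    by rewrite mulr0.
  apply: straddle_leD; first exact: hu.
  apply: straddle_le_sum => r rS; apply: straddle_leZ; first exact: S0.
  by apply: cumulated_straddle => //; case: (hK r).
move=> /(_ hv).
have -> : F c = 0.
  rewrite /F big1// => r _; rewrite /cumulated set_itv1.
  have -> : lebesgue_measure (K r `&` [set c]) = 0%E; last by rewrite /= mulr0.
  apply: (subset_measure0 _ _ (@subIsetr _ _ _)) => //.
    exact: (measurableI _ _ (mK r) (measurable_set1 c)).
  exact: lebesgue_measure_set1.
move=> uF.
apply: (@le_trans _ _ (\sum_(r <- S) (r%:E * (cumulated c (K r) d + e')%:E)))%E.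
  rewrite big_seq [leRHS]big_seq; apply: lee_sum => r rS.
  have := S0 _ rS; rewrite le_eqVlt => /predU1P[<-|r0]; first by rewrite !mul0e.
  have [_ /(_ r0) [_ Kcd hr]] := hK r.
  apply: lee_wpmul2l; first by rewrite lee_fin ltW.
  apply: le_trans hr _; rewrite EFinD; apply: leeD2r.
  rewrite /cumulated fineK; last first.
    by apply: (@lebesgue_itv_fin_num _ c d) => //; exact: measurableI.
  by have /setIidPl -> := Kcd.
under eq_bigr do rewrite -EFinM.
rewrite sumEFin -EFinD lee_fin.
have -> : \sum_(r <- S) r * (cumulated c (K r) d + e') = F d + (\sum_(r <- S) r) * e'.
  by rewrite /F mulr_suml -big_split/=; apply: eq_bigr => r _; ring.
have : (\sum_(r <- S) r + 1) * e' = e by rewrite /e' mulrC divfK// gt_eqF//; lra.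
by rewrite mulrDl mul1r; lra.
Qed.

(** * Operations on absolutely continuous functions *)

Lemma abs_continuous_dist (R : realType) (c d : R) (u : R -> R) (e : R) :
  abs_continuous c d u -> 0 < e -> exists2 delta, 0 < delta &
    forall x y, c <= x -> x <= y -> y <= d -> y - x < delta ->
      `|u y - u x| < e.
Proof.
move=> acu e0; have [delta delta0 H] := acu _ e0.
exists delta => // x y cx xy yd yx.
have := H 1%N (fun=> x) (fun=> y); rewrite !big_ord1; apply => //.
by move=> i j _ _ _; rewrite !ord1.
Qed.

Lemma abs_continuous_within (R : realType) (c d : R) (u : R -> R) :
  abs_continuous c d u -> {within `[c, d], continuous u}.
Proof.
move=> acu; apply/subspace_continuousP => x; rewrite /= in_itv/= => /andP[cx xd].
apply/cvgrPdist_lt => e e0; have [delta delta0 H] := abs_continuous_dist acu e0.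
rewrite /within /= nearE -nbhs_ballE; exists delta => //= y.
rewrite /ball/= in_itv/= ltr_norml => xy /andP[cy yd].
move: xy => /andP[? ?].
have [xy|/ltW yx] := leP x y; last by apply: H => //; lra.
by rewrite distrC; apply: H => //; lra.
Qed.

Lemma abs_continuous_bounded (R : realType) (c d : R) (u : R -> R) :
  abs_continuous c d u ->
  exists2 M, 0 < M & forall x, c <= x -> x <= d -> `|u x| <= M.
Proof.
move=> acu; have [cd|dc] := leP c d; last first.
  by exists 1 => // x cx xd; have := le_trans cx xd; rewrite leNgt dc.
have cu := abs_continuous_within acu.
have [y _ hy] := EVT_max cd cu; have [z _ hz] := EVT_min cd cu.
exists (1 + `|u y| + `|u z|) => [|x cx xd].
  by have := normr_ge0 (u y); have := normr_ge0 (u z); lra.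
have xcd : x \in `[c, d] by rewrite in_itv/= cx.
have := hy _ xcd; have := hz _ xcd; have := ler_norm (u y); have := ler_norm (- u z).
rewrite normrN ler_norml; have := normr_ge0 (u y); have := normr_ge0 (u z) => *.
by apply/andP; split; lra.
Qed.

Lemma abs_continuousM (R : realType) (c d : R) (u v : R -> R) :
  abs_continuous c d u -> abs_continuous c d v ->
  abs_continuous c d (fun x => u x * v x).
Proof.
move=> hu hv e e0.
have [M M0 uM] := abs_continuous_bounded hu.
have [K K0 vK] := abs_continuous_bounded hv.
have eK0 : 0 < e / (2 * K) by rewrite divr_gt0// mulr_gt0.
have eM0 : 0 < e / (2 * M) by rewrite divr_gt0// mulr_gt0.
have [du du0 Hu] := hu _ eK0; have [dv dv0 Hv] := hv _ eM0.
exists (Num.min du dv); first by rewrite lt_min du0.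
move=> n x y xy tI; rewrite lt_min => /andP[lu lv].
have := Hu n x y xy tI lu; have := Hv n x y xy tI lv.
rewrite !ltr_pdivlMr ?mulr_gt0// => {}Hv {}Hu.
have : \sum_(i < n) `|u (y i) * v (y i) - u (x i) * v (x i)| <=
    \sum_(i < n) (`|u (y i) - u (x i)| * K + `|v (y i) - v (x i)| * M).
  apply: ler_sum => i _; have [? ? ?] := xy i.
  have -> : u (y i) * v (y i) - u (x i) * v (x i) =
    (u (y i) - u (x i)) * v (y i) + (v (y i) - v (x i)) * u (x i) by ring.
  apply: le_trans (ler_normD _ _) _; rewrite !normrM lerD// ler_wpM2l//.
    by apply: vK => //; lra.
  by apply: uM => //; lra.
rewrite big_split/= -!mulr_suml; lra.
Qed.

Lemma abs_continuous_cst (R : realType) (c d k : R) : abs_continuous c d (fun=> k).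
Proof.
by apply: (@lipschitz_abs_continuous _ _ _ 0) => *; rewrite subrr normr0 mul0r.
Qed.

Lemma abs_continuous_sum (R : realType) (I : eqType) (s : seq I) (c d : R)
    (u : I -> R -> R) : (forall i, i \in s -> abs_continuous c d (u i)) ->
  abs_continuous c d (fun x => \sum_(i <- s) u i x).
Proof.
elim: s => [_|i s IH h].
  have -> : (fun x => \sum_(j <- [::]) u j x) = fun=> 0.
    by apply/funext => x; rewrite big_nil.
  exact: abs_continuous_cst.
have -> : (fun x => \sum_(j <- i :: s) u j x) = (fun x => u i x + \sum_(j <- s) u j x).
  by apply/funext => x; rewrite big_cons.
apply: abs_continuousD; first by apply: h; rewrite mem_head.
by apply: IH => j js; apply: h; rewrite in_cons js orbT.
Qed.

Lemma abs_continuous_subX (R : realType) (c d s : R) n :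
  abs_continuous c d (fun x => (x - s) ^+ n).
Proof.
elim: n => [|n IH]; first exact: abs_continuous_cst.
have -> : (fun x => (x - s) ^+ n.+1) = (fun x => (x - s) * (x - s) ^+ n).
  by apply/funext => x; rewrite exprS.
apply: abs_continuousM IH; apply: (@lipschitz_abs_continuous _ _ _ 1) => x y _ xy _.
by rewrite opprB addrA subrK mul1r ger0_norm ?subr_ge0.
Qed.

(** * Derivatives as first order estimates *)

Lemma derive_from_dist (R : realType) (a : R) (u : R -> R) (x e : R) :
  derivable_from a u x -> 0 < e -> exists2 delta, 0 < delta &
    forall y, a <= y -> `|y - x| < delta ->
      `|u y - u x - derive_from a u x * (y - x)| <= e * `|y - x|.
Proof.
move=> dux e0; have /cvgrPdist_lt/(_ _ e0) := dux.
rewrite near_withinE near_withinE -nbhs_ballE => -[delta /= delta0 H].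
exists delta => // y ay yx; have [->|yxN] := eqVneq y x.
  by rewrite !subrr mulr0 subr0 normr0 mulr0.
have y'x : y - x != 0 by rewrite subr_eq0.
have := H y; rewrite /ball/= distrC => /(_ yx yxN).
rewrite in_itv/= andbT => /(_ ay) => /ltW.
rewrite /diff_quotient -/(derive_from a u x) => h.
have -> : u y - u x - derive_from a u x * (y - x) =
  ((u y - u x) / (y - x) - derive_from a u x) * (y - x) by field.
by rewrite normrM ler_wpM2r// distrC.
Qed.

Lemma derive_from_is_derive (R : realType) (a : R) (u : R -> R) (x : R) :
  a < x -> derivable_from a u x -> is_derive x 1 u (derive_from a u x).
Proof.
move=> ax dux.
have H : h^-1 *: ((u \o shift x) (h *: 1) - u x) @[h --> 0^'] --> derive_from a u x.
  apply/cvgrPdist_le => e e0; have [delta delta0 D] := derive_from_dist dux e0.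
  rewrite near_withinE -nbhs_ballE; exists (Num.min delta (x - a)) => /=.
    by rewrite lt_min delta0 subr_gt0.
  move=> h; rewrite /ball/= sub0r normrN lt_min => /andP[hd hx] h0.
  move: hx; rewrite ltr_norml => /andP[hx _].
  have := D (h + x); rewrite addrK => /(_ _ hd).
  rewrite -[h *: 1]/(h * 1) mulr1 => {}D.
  have {}D : `|u (h + x) - u x - derive_from a u x * h| <= e * `|h| by apply: D; lra.
  rewrite -[leRHS](@mulfK _ `|h|) ?normr_eq0//.
  have -> : derive_from a u x - h^-1 *: (u (h + x) - u x) =
      - (h^-1 * (u (h + x) - u x - derive_from a u x * h)).
    by rewrite -[_ *: _]/(_ * _); field.
  by rewrite normrN normrM normfV mulrC ler_pM2r// invr_gt0 normr_gt0.
apply: DeriveDef; first by apply/cvg_ex; exists (derive_from a u x).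
exact: cvg_lim H.
Qed.

Lemma is_derive_dist (R : realType) (u : R -> R) (x l e : R) :
  is_derive x 1 u l -> 0 < e -> exists2 delta, 0 < delta &
    forall y, `|y - x| < delta -> `|u y - u x - l * (y - x)| <= e * `|y - x|.
Proof.
case=> du dl e0; have : h^-1 *: ((u \o shift x) (h *: 1) - u x) @[h --> 0^'] --> l.
  by rewrite -dl; exact: du.
move=> /cvgrPdist_le/(_ _ e0); rewrite near_withinE -nbhs_ballE => -[delta /= delta0 H].
exists delta => // y yx; have [->|yxN] := eqVneq y x.
  by rewrite !subrr mulr0 subr0 normr0 mulr0.
have y'x : y - x != 0 by rewrite subr_eq0.
have := H (y - x); rewrite /ball/= sub0r normrN => /(_ yx y'x).
rewrite -[(y - x) *: 1]/((y - x) * 1) mulr1 subrK -[_ *: _]/(_ * _) => h.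
have -> : u y - u x - l * (y - x) = - ((l - (y - x)^-1 * (u y - u x)) * (y - x)) by field.
by rewrite normrN normrM ler_wpM2r.
Qed.

(** Since [x] lies between [y] and [z], the two first order errors at [x] add up to at most
    [e * (z - y)]. *)
Lemma is_derive_straddle (R : realType) (u : R -> R) (x l : R) :
  is_derive x 1 u l -> straddle_le u x l.
Proof.
move=> du e e0; have [delta delta0 H] := is_derive_dist du e0.
exists delta => // y z xy yx xz zx.
have : `|u y - u x - l * (y - x)| <= e * `|y - x|.
  by apply: H; rewrite ler0_norm; lra.
rewrite (@ler0_norm _ (y - x)); last lra.
have : `|u z - u x - l * (z - x)| <= e * `|z - x|.
  by apply: H; rewrite ger0_norm; lra.
rewrite (@ger0_norm _ (z - x)); last lra.
rewrite !ler_norml => /andP[_ hz] /andP[hy _].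
have -> : (l + e) * (z - y) = l * (z - x) - l * (y - x) + e * (z - x) - e * (y - x) by ring.
by move: hz hy; rewrite mulrN; lra.
Qed.

Lemma is_derive_subX_fact (R : realType) (s x : R) (k : nat) :
  is_derive x 1 (fun y => (y - s) ^+ k.+1 / k.+1`!%:R) ((x - s) ^+ k / k`!%:R).
Proof.
have h1 : is_derive x 1 (fun y : R => y - s) 1.
  by apply: is_derive_eq; rewrite subr0.
have h2 := is_deriveX k.+1 h1.
have h3 := is_deriveZ (k.+1`!%:R^-1) h2.
set f := (fun y => _ / _).
have -> : f = k.+1`!%:R^-1 \*: (fun y : R => y - s) ^+ k.+1.
  apply/funext => y; rewrite /f mulrC; congr (_ * _).
  by rewrite exprfctE.
apply: is_derive_eq; rewrite /GRing.scale/= factS natrM.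
have : k`!%:R != 0 :> R by rewrite pnatr_eq0 -lt0n fact_gt0.
have : k.+1%:R != 0 :> R by rewrite pnatr_eq0.
by move=> ? ?; field; apply/andP; split.
Qed.

(** * Taylor sums and the basic integral inequality *)

(** For [u j] equal to [(-1)^j w^(j)] this is the Taylor polynomial of [w] centred at the variable
    point [x] and evaluated at the fixed point [s], which is why its derivative in [x]
    telescopes. *)
Definition taylor_sum (R : realType) (u : nat -> R -> R) (s : R) (k : nat) (x : R) : R :=
  \sum_(j < k) u j x * ((x - s) ^+ j / j`!%:R).

(** Consecutive terms cancel and only the top one survives. Its derivative [du k] is left free
    because at the highest order it is known only through an inequality. *)
Lemma is_derive_taylor_sum (R : realType) (u : nat -> R -> R) (du : nat -> R) (s x : R)
    (k : nat) :
  (forall j, (j <= k)%N -> is_derive x 1 (u j) (du j)) ->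
  (forall j, (j < k)%N -> du j = - u j.+1 x) ->
  is_derive x 1 (taylor_sum u s k.+1) (du k * ((x - s) ^+ k / k`!%:R)).
Proof.
elim: k => [|k IH] hu hd.
  have -> : taylor_sum u s 1 = u 0%N.
    by apply/funext => y; rewrite /taylor_sum big_ord1 expr0 fact0 divr1 mulr1.
  by rewrite expr0 fact0 divr1 mulr1; exact: hu.
have -> : taylor_sum u s k.+2 = taylor_sum u s k.+1 +
    u k.+1 * (fun y => (y - s) ^+ k.+1 / k.+1`!%:R).
  by apply/funext => y; rewrite /taylor_sum big_ord_recr.
have IH' : is_derive x 1 (taylor_sum u s k.+1) (du k * ((x - s) ^+ k / k`!%:R)).
  by apply: IH => j jk; [apply: hu; exact: ltnW|apply: hd; exact: ltnW].
have hk := hu _ (leqnn k.+1).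
have hp := is_derive_subX_fact s x k.
apply: (is_derive_eq (is_deriveD IH' (is_deriveM hk hp))).
by rewrite hd// /GRing.scale/=; ring.
Qed.

Lemma abs_continuous_taylor_sum (R : realType) (u : nat -> R -> R) (s c d : R) (k : nat) :
  (forall j, (j < k)%N -> abs_continuous c d (u j)) ->
  abs_continuous c d (taylor_sum u s k).
Proof.
move=> hu.
have -> : taylor_sum u s k =
    fun x => \sum_(j <- index_iota 0 k) u j x * ((x - s) ^+ j * j`!%:R^-1).
  by apply/funext => x; rewrite /taylor_sum big_mkord.
apply: abs_continuous_sum => j; rewrite mem_index_iota => /= jk.
apply: abs_continuousM; first exact: hu.
by apply: abs_continuousM; [exact: abs_continuous_subX|exact: abs_continuous_cst].
Qed.

Lemma taylor_sum_id (R : realType) (u : nat -> R -> R) (s : R) (k : nat) :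
  (0 < k)%N -> taylor_sum u s k s = u 0%N s.
Proof.
case: k => // k _; rewrite /taylor_sum big_ord_recl/= expr0 fact0 divr1 mulr1.
rewrite big1 ?addr0// => i _; rewrite subrr expr0n/= mul0r mulr0//.
Qed.

Lemma taylor_sum_ge (R : realType) (u : nat -> R -> R) (s x : R) (k : nat) :
  (0 < k)%N -> s <= x -> (forall j, (j < k)%N -> 0 <= u j x) ->
  u 0%N x <= taylor_sum u s k x.
Proof.
case: k => // k _ sx u0; rewrite /taylor_sum big_ord_recl/= expr0 fact0 divr1 mulr1.
rewrite lerDl sumr_ge0// => i _; apply: mulr_ge0; first by apply: u0; rewrite /bump/= ltnS ltn_ord.
by rewrite divr_ge0// exprn_ge0// subr_ge0.
Qed.

(* The weighted lower order Taylor sums absorb the terms [beta i * u i]. *)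
Lemma decay_integral_le (R : realType) (n : nat) (u : nat -> R -> R) (s s' : R)
    (beta : nat -> R) (phi : R -> R) (N : set R) :
  s <= s' ->
  (forall j, (j <= n)%N -> abs_continuous s s' (u j)) ->
  (forall j x, (j <= n)%N -> s <= x -> x <= s' -> 0 <= u j x) ->
  u 0%N s' <= u 0%N s ->
  (forall i, 0 <= beta i) ->
  (forall x, s <= x -> x <= s' -> 0 <= phi x) ->
  leb.-negligible (N : set (lebesgue_line R)) ->
  (forall x, s < x -> x < s' -> ~ N x -> exists du : nat -> R,
     [/\ forall j, (j <= n)%N -> is_derive x 1 (u j) (du j),
         forall j, (j < n)%N -> du j = - u j.+1 x &
         du n <= - phi x + \sum_(1 <= i < n.+1) beta i * u i x]) ->
  (\int[leb]_(x in (`[s, s'] : set (lebesgue_line R)))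
      (phi x * ((x - s) ^+ n / n`!%:R))%:E <=
   ((1 + \sum_(1 <= i < n.+1) beta i * (s' - s) ^+ (n.+1 - i)) *
    (u 0%N s - u 0%N s'))%:E)%E.
Proof.
move=> ss' acu u0 u0s beta0 phi0 negN hdu.
(* The factorials turn [(x - s)^(i-1) / (i-1)!], which appears in the derivative of the Taylor sum
   of length [i], into what remains of [(x - s)^n / n!] once [(x - s)^(n+1-i)] is bounded by
   [(s' - s)^(n+1-i)]. *)
pose gamma i := beta i * (s' - s) ^+ (n.+1 - i) * ((i.-1)`!%:R / n`!%:R).
pose Psi x := taylor_sum u s n.+1 x +
  \sum_(i <- index_iota 1 n.+1) gamma i * taylor_sum u s i x.
have fact_pos k : 0 < k`!%:R :> R by rewrite ltr0n fact_gt0.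
have ss0 : 0 <= s' - s by rewrite subr_ge0.
have gamma0 i : 0 <= gamma i.
  by rewrite /gamma !mulr_ge0// ?exprn_ge0// ?invr_ge0 ltW.
have gammaE i : (0 < i)%N -> (i < n.+1)%N -> gamma i <= beta i * (s' - s) ^+ (n.+1 - i).
  move=> i0 iN; rewrite /gamma ler_piMr ?mulr_ge0 ?exprn_ge0//.
  by rewrite ler_pdivrMr// mul1r ler_nat leq_fact// -ltnS prednK// ltnW.
have acP : abs_continuous s s' Psi.
  apply: abs_continuousD.
    by apply: abs_continuous_taylor_sum => j jn; exact: acu.
  apply: abs_continuous_sum => i; rewrite mem_index_iota => /andP[_ iN].
  apply: abs_continuousM; first exact: abs_continuous_cst.
  by apply: abs_continuous_taylor_sum => j ji; apply: acu; rewrite -ltnS (ltn_trans ji).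
have p0 x k : s <= x -> 0 <= (x - s) ^+ k / k`!%:R.
  by move=> sx; rewrite divr_ge0 ?exprn_ge0 ?subr_ge0// ltW.
apply: le_trans (abs_continuous_integral_le ss' acP _ negN _) _.
- by move=> x sx xs'; rewrite mulr_ge0 ?phi0 ?p0.
- move=> x sx xs' nNx; have [du [du1 du2 dun]] := hdu _ sx xs' nNx.
  apply: (@straddle_le_trans _ _ _ (du n * ((x - s) ^+ n / n`!%:R) +
    \sum_(i <- index_iota 1 n.+1) gamma i *
      (du i.-1 * ((x - s) ^+ i.-1 / (i.-1)`!%:R)))).
    set p := (x - s) ^+ n / n`!%:R.
    have pp : 0 <= p by apply: p0; exact: ltW.
    have : du n * p <= (- phi x + \sum_(1 <= i < n.+1) beta i * u i x) * p.
      exact: ler_wpM2r.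
    move=> dup; rewrite -lerBrDr; apply: le_trans dup _.
    rewrite mulrDl mulNr lerD2l mulr_suml -sumrN.
    rewrite big_seq [leRHS]big_seq; apply: ler_sum => i.
    rewrite mem_index_iota => /andP[i0 iN].
    have -> : du i.-1 = - u i x by rewrite du2 ?prednK//; case: i i0 iN.
    rewrite mulNr mulrN opprK.
    have ui : 0 <= u i x by apply: u0; [|exact: ltW|exact: ltW].
    have pE : p = (x - s) ^+ (n.+1 - i) * (x - s) ^+ i.-1 / n`!%:R.
      rewrite /p -exprD; congr (_ ^+ _ / _).
      by case: i i0 iN {ui} => // i _; rewrite ltnS subSS/= => /ltnW/subnK.
    have : (x - s) ^+ (n.+1 - i) <= (s' - s) ^+ (n.+1 - i).
      by rewrite lerXn2r ?nnegrE; lra.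
    have -> : gamma i * (u i x * ((x - s) ^+ i.-1 / (i.-1)`!%:R)) =
        beta i * u i x * ((s' - s) ^+ (n.+1 - i) * (x - s) ^+ i.-1 / n`!%:R).
      rewrite /gamma; have := fact_pos i.-1; have := fact_pos n => ? ?.
      by field; rewrite !gt_eqF.
    move=> h; rewrite pE ler_wpM2l ?mulr_ge0// ler_wpM2r ?invr_ge0 ?(ltW (fact_pos _))//.
    by rewrite ler_wpM2r// exprn_ge0// subr_ge0 ltW.
  apply: straddle_leD.
    apply: is_derive_straddle; exact: is_derive_taylor_sum.
  apply: straddle_le_sum => i; rewrite mem_index_iota => /andP[i0 iN].
  apply: straddle_leZ => //; apply: is_derive_straddle.
  case: i i0 iN => //= i _ iN; apply: is_derive_taylor_sum => j ji.
    by apply: du1; rewrite -ltnS (leq_ltn_trans ji)// ltnW.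
  by apply: du2; rewrite (ltn_trans ji).
rewrite lee_fin.
(* At [s] every Taylor sum equals [u 0 s], at [s'] each is at least [u 0 s']; hence the total
   decrease of [Psi] is controlled by that of [u 0]. *)
have Ps : Psi s = (1 + \sum_(i <- index_iota 1 n.+1) gamma i) * u 0%N s.
  rewrite /Psi taylor_sum_id// mulrDl mul1r mulr_suml; congr (_ + _).
  rewrite big_seq [RHS]big_seq; apply: eq_bigr => i; rewrite mem_index_iota.
  by move=> /andP[i0 _]; rewrite taylor_sum_id.
have Ps' : (1 + \sum_(i <- index_iota 1 n.+1) gamma i) * u 0%N s' <= Psi s'.
  rewrite mulrDl mul1r mulr_suml; apply: lerD.
    by apply: taylor_sum_ge => // j jn; exact: u0.
  rewrite big_seq [leRHS]big_seq; apply: ler_sum => i; rewrite mem_index_iota.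
  move=> /andP[i0 iN]; apply: ler_wpM2l => //; apply: taylor_sum_ge => // j ji.
  by apply: u0 => //; rewrite -ltnS (ltn_trans ji).
apply: (@le_trans _ _ ((1 + \sum_(i <- index_iota 1 n.+1) gamma i) * (u 0%N s - u 0%N s'))).
  by rewrite mulrBr Ps lerD2l lerN2.
apply: ler_wpM2r; first by rewrite subr_ge0.
rewrite lerD2l big_seq [leRHS]big_seq; apply: ler_sum => i; rewrite mem_index_iota.
by move=> /andP[? ?]; exact: gammaE.
Qed.

(** * Essential suprema and measurability of [f] *)

Lemma lebesgue_line_measurable (R : realType) (A : set R) :
  measurable A -> measurable (A : set (lebesgue_line R)).
Proof. by move=> mA; exact: sub_caratheodory. Qed.

Lemma leb_aeS (R : realType) (P P' : R -> Prop) :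
  (forall x, P x -> P' x) -> (\forall x \ae leb, P x) -> \forall x \ae leb, P' x.
Proof. by move=> PP'; apply: negligibleS => x /= nP' /PP'. Qed.

(** The infimum is an essential bound itself: the exceptional sets of the bounds [y + 1/(k+1)] are
    countably many null sets. *)
Lemma ess_sup_on_leP (R : realType) (D : set R) (u : R -> R) (y : R) :
  (ess_sup_on D u <= y%:E)%E <-> \forall x \ae leb, D x -> u x <= y.
Proof.
split=> [uy|uy]; last first.
  apply: ereal_inf_lbound.
  by move: uy; apply: leb_aeS => x /= uy Dx; rewrite lee_fin; exact: uy.
have H k : \forall x \ae (@completed_lebesgue_measure R), D x -> u x <= y + k.+1%:R^-1.
  have : (ess_sup_on D u < (y + k.+1%:R^-1)%:E)%E.
    by apply: le_lt_trans uy _; rewrite lte_fin ltrDl.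
  case/ereal_inf_lt => z /= hz zy; move: hz; apply: leb_aeS => x uz Dx.
  by rewrite -lee_fin; exact: le_trans (uz Dx) (ltW zy).
move: (ae_foralln H); apply: leb_aeS => x /= h Dx; apply/ler_addgt0Pr => e e0.
have [k ke] : exists k, k.+1%:R^-1 < e.
  by exists (Num.truncn e^-1); rewrite invf_plt ?posrE// truncnS_gt.
by apply: le_trans (h k Dx) _; rewrite lerD2l ltW.
Qed.

Lemma ess_sup_on_subset (R : realType) (D D' : set R) (u : R -> R) :
  D `<=` D' -> (ess_sup_on D u <= ess_sup_on D' u)%E.
Proof.
move=> DD'; apply: ereal_inf_le_tmp => y /= uy.
by move: uy; apply: leb_aeS => x /= uy Dx; apply: uy; exact: DD'.
Qed.

(** Over a null set the essential supremum is [-oo]; a nonempty interval inside [D] rules this out,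
    since a negative essential bound would make that interval null. *)
Lemma ess_sup_on_ge0 (R : realType) (D : set R) (u : R -> R) (c d : R) :
  c < d -> `]c, d[ `<=` D -> (forall x, D x -> 0 <= u x) ->
  (0 <= ess_sup_on D u)%E.
Proof.
move=> cd cdD u0; apply: le_ereal_inf_tmp => y /= uy; rewrite leNgt; apply/negP => y0.
have neg : leb.-negligible (`]c, d[ : set (lebesgue_line R)).
  apply: negligibleS uy => x /= xcd; apply/existsNP; exists (cdD _ xcd).
  by apply/negP; rewrite -ltNge; apply: lt_le_trans y0 _; rewrite lee_fin; apply/u0/cdD.
move: neg => /negligibleP; have mcd : measurable (`]c, d[ : set (lebesgue_line R)).
  by apply: lebesgue_line_measurable; exact: measurable_itv.
move=> /(_ mcd) neg; have : lebesgue_measure `]c, d[ = 0%E := neg.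
rewrite lebesgue_measure_itv/= lte_fin cd => /eqP.
by rewrite -EFinD eqe subr_eq0 gt_eqF.
Qed.

Lemma ess_sup_on_fin_num (R : realType) (a : R) (D : set R) (u : R -> R) (c d c' d' : R) :
  Linfty_loc a u -> c < d -> `]c, d[ `<=` D -> (forall x, D x -> 0 <= u x) ->
  a <= c' -> D `<=` `[c', d'] -> ess_sup_on D u \is a fin_num.
Proof.
move=> [_ hu] cd cdD u0 ac' Dcd'; rewrite ge0_fin_numE ?(ess_sup_on_ge0 cd)//.
apply: le_lt_trans (hu c' d' ac'); apply: ereal_inf_le_tmp => y /= uy.
move: uy; apply: leb_aeS => x /= uy Dx; apply: le_trans (uy (Dcd' _ Dx)).
by rewrite lee_fin ler_norm.
Qed.

Lemma ae_le_ess_sup_on (R : realType) (D : set R) (u : R -> R) :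
  ess_sup_on D u \is a fin_num ->
  \forall x \ae leb, D x -> u x <= fine (ess_sup_on D u).
Proof. by move=> fu; apply/ess_sup_on_leP; rewrite fineK. Qed.

Definition moving_itv (R : realType) (sigma a r : R) : set R :=
  `]r / sigma, r * sigma[ `&` `[a, +oo[.

Lemma moving_itv_fin_num (R : realType) (sigma a r : R) (u : R -> R) :
  1 < sigma -> 0 < a -> a <= r -> Linfty_loc a u -> (forall x, a <= x -> 0 <= u x) ->
  ess_sup_on (moving_itv sigma a r) u \is a fin_num.
Proof.
move=> s1 a0 ar Lu u0; have r0 : 0 < r by lra.
apply: (@ess_sup_on_fin_num _ a _ _ r (r * sigma) a (r * sigma)) => //.
- by rewrite ltr_pMr.
- move=> x; rewrite /moving_itv /= !in_itv/= andbT => /andP[rx xr]; split; last lra.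
  apply/andP; split => //; apply: le_lt_trans rx.
  by rewrite ler_pdivrMr ?ler_peMr//; lra.
- by move=> x; rewrite /moving_itv/= !in_itv/= andbT => -[_]; exact: u0.
- by move=> x; rewrite /moving_itv/= !in_itv/= andbT => -[/andP[_ /ltW ->] ->].
Qed.

(* The essential supremum over a moving interval is lower semicontinuous. *)
Lemma measurable_moving_ess_sup (R : realType) (sigma a : R) (u : R -> R) :
  1 < sigma -> 0 < a -> Linfty_loc a u -> (forall x, a <= x -> 0 <= u x) ->
  lebesgue_measurable_fun `[a, +oo[
    (fun r => fine (ess_sup_on (moving_itv sigma a r) u)).
Proof.
move=> s1 a0 Lu u0; pose E r := ess_sup_on (moving_itv sigma a r) u.
have s0 : 0 < sigma by lra.
have E_fin r : a <= r -> E r \is a fin_num.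
  by move=> ar; exact: moving_itv_fin_num.
have lsc r y : a <= r -> y < fine (E r) -> exists2 eta, 0 < eta & forall r',
    a <= r' -> r - eta < r' < r + eta -> y < fine (E r').
  move=> ar yE; apply: contrapT => nex.
  suff : (E r <= y%:E)%E by rewrite -(fineK (E_fin _ ar)) lee_fin leNgt yE.
  apply/ess_sup_on_leP.
  (* If every neighbourhood of [r] fails, then [y] bounds [u] almost everywhere on each slightly
     shrunk interval, and these exhaust the open interval attached to [r]. *)
  have H k : \forall x \ae (@completed_lebesgue_measure R),
      (`]r / sigma + k.+1%:R^-1, r * sigma - k.+1%:R^-1[ `&` `[a, +oo[) x -> u x <= y.
    apply/ess_sup_on_leP; rewrite leNgt; apply/negP => yk; apply: nex.
    have k0 : 0 < k.+1%:R^-1 :> R by rewrite invr_gt0.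
    (* The endpoints depend on [r] through the factors [1 / sigma] and [sigma], so this shift of [r]
       moves them by at most [1/(k+1)]. *)
    exists (k.+1%:R^-1 / sigma) => [|r' ar' /andP[r1 r2]]; first by rewrite divr_gt0.
    rewrite -lte_fin fineK ?E_fin//; apply: lt_le_trans yk _.
    apply: ess_sup_on_subset => x /= []; rewrite !in_itv/= !andbT => /andP[x1 x2] ax.
    split; rewrite /= in_itv/= ?ax//; apply/andP; split.
      apply: le_lt_trans x1.
      have : r' / sigma <= (r + k.+1%:R^-1 / sigma) / sigma.
        by rewrite ler_pM2r ?invr_gt0// ltW.
      move=> /le_trans; apply; rewrite mulrDl lerD2l ler_pdivrMr// ler_pdivrMr//.
      by rewrite -mulrA ler_peMr ?ltW//; nra.
    apply: lt_le_trans x2 _.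
    have : (r - k.+1%:R^-1 / sigma) * sigma <= r' * sigma by rewrite ler_pM2r// ltW.
    by rewrite mulrBl divfK ?gt_eqF.
  move: (ae_foralln H); apply: leb_aeS => x /= h [/=]; rewrite !in_itv/= !andbT => /andP[x1 x2] ax.
  pose e := Num.min (x - r / sigma) (r * sigma - x).
  have e0 : 0 < e by rewrite lt_min !subr_gt0 x1.
  have [e1 e2] : e <= x - r / sigma /\ e <= r * sigma - x.
    by rewrite !ge_min !lexx orbT.
  have [k ke] : exists k, k.+1%:R^-1 < e.
    by exists (Num.truncn e^-1); rewrite invf_plt ?posrE// truncnS_gt.
  apply: (h k); split; rewrite /= in_itv/= ?ax//; apply/andP; split.
    by rewrite -ltrBrDl; exact: lt_le_trans ke e1.
  by rewrite ltrBrDr -ltrBrDl; exact: lt_le_trans ke e2.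
move=> ma.
apply: (measurability _ (RGenOInfty.measurableE R)) => // _ [_ [y ->] <-].
pose O := \bigcup_(B in [set B : set R | open B /\ forall r, B r -> a <= r -> y < fine (E r)]) B.
have oO : open O by apply: bigcup_open => B [].
have -> : `[a, +oo[ `&` (fun r => fine (E r)) @^-1` `]y, +oo[ = `[a, +oo[ `&` O :> set R.
  apply/seteqP; split => r /= [+ yr]; rewrite in_itv/= andbT => ar; split => //.
    move: yr; rewrite in_itv/= andbT => yr.
    have [eta eta0 he] := lsc _ _ ar yr.
    exists `]r - eta, r + eta[%classic => /=; last by rewrite in_itv/=; apply/andP; split; lra.
    split; first exact: itv_open.
    by move=> r' /=; rewrite in_itv/= => rr' ar'; exact: he.
  by move: yr => [B [_ hB] Br]; rewrite in_itv/= andbT; exact: hB.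
apply: lebesgue_line_measurable; apply: measurableI => //; exact: open_measurable.
Qed.

Definition f_den (R : realType) (m : nat) (sigma a : R) (b : nat -> R -> R) (r : R) : R :=
  1 + \sum_(1 <= i < m) r ^+ (m - i) * fine (ess_sup_on (moving_itv sigma a r) (b i)).

Lemma fine_ess_sup_on_ge0 (R : realType) (D : set R) (u : R -> R) (c d : R) :
  c < d -> `]c, d[ `<=` D -> (forall x, D x -> 0 <= u x) ->
  0 <= fine (ess_sup_on D u).
Proof. by move=> cd cdD u0; apply: fine_ge0; exact: ess_sup_on_ge0 cd cdD u0. Qed.

Lemma moving_itvP (R : realType) (sigma a r x : R) :
  moving_itv sigma a r x <-> [/\ r / sigma < x, x < r * sigma & a <= x].
Proof.
rewrite /moving_itv /= !in_itv/= andbT; split=> [[/andP[]]//|[-> -> ->]//].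
Qed.

Lemma itv_sub_moving_itv (R : realType) (sigma a s s' x : R) :
  1 < sigma -> 0 < a -> a <= s -> s' <= sigma * s -> s < x -> x < s' ->
  `]s, s'[ `<=` moving_itv sigma a x.
Proof.
move=> s1 a0 as_ s's sx xs' y /=; rewrite in_itv/= => /andP[sy ys'].
have s0 : 0 < sigma by lra.
have h : sigma * s < sigma * y by rewrite ltr_pM2l.
have h' : s * sigma < x * sigma by rewrite ltr_pM2r.
by apply/moving_itvP; split; [rewrite ltr_pdivrMr// mulrC| |]; lra.
Qed.

(** The bound [s' <= sigma * s] places []s, s'[] inside the interval attached to [x], and
    [s' <= 2 * s] gives [s' - s <= s < x]; the comparison then holds term by term. *)
Lemma f_den_ge (R : realType) (m : nat) (sigma a s s' x : R) (b : nat -> R -> R) :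
  1 < sigma -> 0 < a -> a <= s -> s' <= sigma * s -> s' <= 2 * s ->
  s < x -> x < s' ->
  (forall i, (0 < i < m)%N -> Linfty_loc a (b i) /\ forall r, a <= r -> 0 <= b i r) ->
  1 + \sum_(1 <= i < m) fine (ess_sup_on `]s, s'[ (b i)) * (s' - s) ^+ (m - i)
    <= f_den m sigma a b x.
Proof.
move=> s1 a0 as_ s's s'2 sx xs' hb; rewrite lerD2l.
apply: ler_sum_nat => i /hb[Lb b0]; rewrite mulrC.
have bs r : `]s, s'[%classic r -> 0 <= b i r.
  by rewrite /= in_itv/= => /andP[sr _]; apply: b0; lra.
have sub := @itv_sub_moving_itv _ sigma a s s' x s1 a0 as_ s's sx xs'.
have ss' : s < s' by lra.
apply: ler_pM.
- by apply: exprn_ge0; lra.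
- exact: fine_ess_sup_on_ge0 ss' _ bs.
- by rewrite lerXn2r ?nnegrE; lra.
- apply: fine_le; last exact: ess_sup_on_subset.
    apply: (@ess_sup_on_fin_num _ a _ _ s s' s s') => //.
    by move=> y /=; rewrite !in_itv/= => /andP[/ltW-> /ltW->].
  by apply: moving_itv_fin_num => //; lra.
Qed.

Lemma f_den_ge1 (R : realType) (m : nat) (sigma a x : R) (b : nat -> R -> R) :
  1 < sigma -> 0 < a -> a <= x ->
  (forall i, (0 < i < m)%N -> Linfty_loc a (b i) /\ forall r, a <= r -> 0 <= b i r) ->
  1 <= f_den m sigma a b x.
Proof.
move=> s1 a0 ax hb; rewrite lerDl big_nat_cond sumr_ge0// => i; rewrite andbT => /hb[Lb b0].
apply: mulr_ge0; first by apply: exprn_ge0; lra.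
have xs : x < x * sigma by rewrite ltr_pMr//; lra.
apply: (fine_ess_sup_on_ge0 xs) => y; last by move=> /moving_itvP[_ _]; exact: b0.
rewrite /= in_itv/= => /andP[xy yx]; apply/moving_itvP; split => //; last lra.
apply: le_lt_trans xy; rewrite ler_pdivrMr ?ler_peMr//; lra.
Qed.

Lemma measurable_f_fun (R : realType) (m : nat) (sigma a : R) (q : R -> R) (b : nat -> R -> R) :
  1 < sigma -> 0 < a -> Linfty_loc a q ->
  (forall i, (0 < i < m)%N -> Linfty_loc a (b i) /\ forall r, a <= r -> 0 <= b i r) ->
  lebesgue_measurable_fun `[a, +oo[ (f_fun m sigma a q b).
Proof.
move=> s1 a0 [mq _] hb.
have md : lebesgue_measurable_fun `[a, +oo[ (f_den m sigma a b).
  pose h i r := if (0 < i < m)%N then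
    r ^+ (m - i) * fine (ess_sup_on (moving_itv sigma a r) (b i)) else 0.
  have -> : f_den m sigma a b = fun r => 1 + \sum_(i <- index_iota 1 m) h i r.
    by apply/funext => r; congr (_ + _); apply: eq_big_nat => i im; rewrite /h im.
  apply: measurable_funD; [exact: measurable_cst|apply: measurable_sum => i; rewrite /h].
  have [/hb[Lb b0]|_] := boolP (0 < i < m)%N; last exact: measurable_cst.
  apply: measurable_funM; last exact: measurable_moving_ess_sup.
  apply: measurable_funX; move=> _ Y mY.
  by apply: lebesgue_line_measurable; apply: measurableI.
(* The quotient becomes a product with a power of exponent [-1], legitimate because the denominator
   is at least 1. *)
have -> : lebesgue_measurable_fun `[a, +oo[ (f_fun m sigma a q b) =
    lebesgue_measurable_fun `[a, +oo[ (fun r => q r * f_den m sigma a b r `^ (-1)).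
  apply/propext; split; apply: eq_measurable_fun => r; rewrite inE/= in_itv/= andbT => ar;
    by rewrite powR_inv1//; apply: le_trans (f_den_ge1 s1 a0 ar hb).
apply: measurable_funM; first exact: mq.
exact: (measurableT_comp (@measurable_powR R (-1)) md).
Qed.

Lemma f_fun_ge0 (R : realType) (m : nat) (sigma a x : R) (q : R -> R) (b : nat -> R -> R) :
  1 < sigma -> 0 < a -> a <= x -> (forall r, a <= r -> 0 <= q r) ->
  (forall i, (0 < i < m)%N -> Linfty_loc a (b i) /\ forall r, a <= r -> 0 <= b i r) ->
  0 <= f_fun m sigma a q b x.
Proof.
move=> s1 a0 ax q0 hb; apply: divr_ge0; first exact: q0.
by apply: le_trans (f_den_ge1 s1 a0 ax hb).
Qed.

(** * Integrals over half-lines *)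

Lemma ge0_integral_tail_split (R : realType) (a c d : R) (phi : R -> R) :
  lebesgue_measurable_fun `[a, +oo[ phi -> (forall x, a <= x -> 0 <= phi x) ->
  a <= c -> c <= d ->
  (\int[leb]_(x in (`[c, +oo[ : set (lebesgue_line R))) (phi x)%:E =
   \int[leb]_(x in (`[c, d[ : set (lebesgue_line R))) (phi x)%:E +
   \int[leb]_(x in (`[d, +oo[ : set (lebesgue_line R))) (phi x)%:E)%E.
Proof.
move=> mphi phi0 ac cd.
have -> : `[c, +oo[%classic = `[c, d[ `|` `[d, +oo[ :> set R.
  apply/seteqP; split => x /=; rewrite !in_itv/= ?andbT.
    by case: (leP d x) => dx cx; [right|left; rewrite cx].
  by case => [/andP[]//|]; exact: le_trans.
rewrite ge0_integral_setU; [by []| | | | |].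
- by apply: lebesgue_line_measurable; exact: measurable_itv.
- by apply: lebesgue_line_measurable; exact: measurable_itv.
- apply/measurable_EFinP; apply: measurable_funS mphi.
    by apply: lebesgue_line_measurable; exact: measurable_itv.
  move=> x /= [|]; rewrite !in_itv/= ?andbT; first by move=> /andP[? _]; lra.
  by move=> dx; lra.
- move=> x /= [|]; rewrite in_itv/= lee_fin ?andbT; first by move=> /andP[? _]; apply: phi0; lra.
  by move=> dx; apply: phi0; lra.
- rewrite disj_set2E; apply/eqP/seteqP; split => // x [] /=; rewrite !in_itv/= andbT.
  by move=> /andP[_ xd]; rewrite leNgt xd.
Qed.

(** Monotone convergence along [[a, a + n[]: the tail from [a + n] is the finite total minus the
    integral over that interval. *)
Lemma ge0_integral_tail_cvg0 (R : realType) (a : R) (phi : R -> R) (e : R) :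
  lebesgue_measurable_fun `[a, +oo[ phi -> (forall x, a <= x -> 0 <= phi x) ->
  (\int[leb]_(x in (`[a, +oo[ : set (lebesgue_line R))) (phi x)%:E < +oo)%E -> 0 < e ->
  exists2 c, a <= c &
   (\int[leb]_(x in (`[c, +oo[ : set (lebesgue_line R))) (phi x)%:E <= e%:E)%E.
Proof.
move=> mphi phi0 fphi e0.
pose F n : set (lebesgue_line R) := `[a, a + n%:R[%classic.
have FU : \bigcup_n F n = `[a, +oo[%classic.
  apply/seteqP; split => x; first by move=> [n _]; rewrite /F/= !in_itv/= andbT => /andP[].
  rewrite /= in_itv/= andbT => ax; exists (Num.truncn (x - a)).+1 => //.
  by rewrite /F/= in_itv/= ax/= -ltrBlDl truncnS_gt.
have mF i : measurable (F i) by apply: lebesgue_line_measurable; exact: measurable_itv.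
have ndF : nondecreasing_seq F.
  move=> i j ij; rewrite subsetEset => x; rewrite /F/= !in_itv/= => /andP[-> /lt_le_trans]; apply.
  by rewrite lerD2l ler_nat.
have Fa i x : F i x -> a <= x by rewrite /F/= in_itv/= => /andP[].
have fin0 : (\int[leb]_(x in (`[a, +oo[ : set (lebesgue_line R))) (phi x)%:E \is a fin_num)%E.
  by rewrite ge0_fin_numE// integral_ge0// => x /=; rewrite in_itv/= andbT lee_fin => /phi0.
have mphiF i : measurable_fun (F i) (EFin \o phi).
  apply/measurable_EFinP; apply: measurable_funS mphi.
    by apply: lebesgue_line_measurable; exact: measurable_itv.
  by move=> x /Fa; rewrite /= in_itv/= andbT.
have phiF i x : F i x -> (0 <= (EFin \o phi) x)%E.
  by move=> /Fa ax; rewrite lee_fin; exact: phi0.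
have := @ge0_nondecreasing_set_cvg_integral _ _ R F (EFin \o phi) leb ndF mF mphiF phiF.
rewrite FU -(fineK fin0) => /fine_cvgP[_ /cvgrPdist_le/(_ _ e0)[n _ /(_ n (leqnn n))]] /=.
have an : a <= a + n%:R by rewrite lerDl.
have := ge0_integral_tail_split mphi phi0 (lexx a) an.
rewrite -/(F n); set A := (\int[_]_(_ in F n) _)%E; set T := (X in (_ = A + X)%E -> _).
move=> E dist; exists (a + n%:R) => //; rewrite -/T.
have T0 : (0 <= T)%E.
  by apply: integral_ge0 => x /=; rewrite in_itv/= andbT lee_fin => anx; apply: phi0; lra.
have A0 : (0 <= A)%E by apply: integral_ge0 => x /Fa ax; rewrite lee_fin; exact: phi0.
move: fin0 dist; rewrite E fin_numD => /andP[fA fT].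
rewrite fineD// addrAC subrr add0r ger0_norm ?fine_ge0// => Te.
by rewrite -(fineK fT) lee_fin.
Qed.

(** * Decay of solutions *)

Definition signed_deriv (R : realType) (a : R) (w : R -> R) (j : nat) (x : R) : R :=
  (-1) ^+ j * deriven_from a j w x.

Lemma signed_deriv0 (R : realType) (a : R) (w : R -> R) : signed_deriv a w 0 = w.
Proof. by apply/funext => x; rewrite /signed_deriv expr0 mul1r. Qed.

Lemma is_derive_signed_deriv (R : realType) (a : R) (w : R -> R) (j : nat) (x : R) :
  a < x -> derivable_from a (deriven_from a j w) x ->
  is_derive x 1 (signed_deriv a w j) (- signed_deriv a w j.+1 x).
Proof.
move=> ax /(derive_from_is_derive ax) dw.
rewrite /signed_deriv exprS mulN1r mulNr opprK.
exact: (is_deriveZ ((-1) ^+ j) dw).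
Qed.

Lemma solution_nonincreasing (R : realType) (m : nat) (a : R) (Q : R -> 'rV[R]_m -> R)
    (w : R -> R) : (1 < m)%N -> is_solution a Q w ->
  forall x y, a <= x -> x <= y -> w y <= w x.
Proof.
move=> m1 [dw acw _ sw] x y ax xy.
apply: (abs_continuous_nonincreasing xy (acw 0%N (ltnW m1) _ _ ax) (negligible_set0 _)).
move=> z xz zy _; have az : a < z by apply: le_lt_trans xz.
apply: (@straddle_le_trans _ _ _ (- signed_deriv a w 1 z)).
  by rewrite oppr_le0; apply: sw => //; exact: ltW.
apply: is_derive_straddle; have := @is_derive_signed_deriv R a w 0 z az.
by rewrite signed_deriv0; apply; apply: dw => //; exact: ltW.
Qed.

(** A nonnegative nonincreasing function that vanishes once vanishes from then on, which regularity
    excludes. *)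
Lemma regular_solution_gt0 (R : realType) (m : nat) (a : R) (Q : R -> 'rV[R]_m -> R)
    (w : R -> R) : (1 < m)%N -> is_solution a Q w -> is_regular a w ->
  forall x, a <= x -> 0 < w x.
Proof.
move=> m1 sw [_ rw] x ax; have [y xy wy] := rw _ ax.
apply: lt_le_trans (solution_nonincreasing m1 sw ax xy).
have [_ _ _ /(_ 0%N y (ltnW m1) (le_trans ax xy))] := sw.
by rewrite expr0 mul1r lt_neqAle eq_sym wy.
Qed.

Lemma measurable_tail_integrand (R : realType) (a : R) (n : nat) (f : R -> R) :
  lebesgue_measurable_fun `[a, +oo[ f ->
  lebesgue_measurable_fun `[a, +oo[ (fun x => x ^+ n * f x).
Proof.
move=> mf; apply: measurable_funM; last exact: mf.
apply: measurable_funX => _ Y mY.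
by apply: lebesgue_line_measurable; exact: measurableI.
Qed.

Lemma tail_fin_num (R : realType) (a c : R) (phi : R -> R) :
  lebesgue_measurable_fun `[a, +oo[ phi -> (forall x, a <= x -> 0 <= phi x) ->
  a <= c ->
  (\int[leb]_(x in (`[a, +oo[ : set (lebesgue_line R))) (phi x)%:E < +oo)%E ->
  (\int[leb]_(x in (`[c, +oo[ : set (lebesgue_line R))) (phi x)%:E)%E \is a fin_num.
Proof.
move=> mphi phi0 ac fin; rewrite ge0_fin_numE; last first.
  apply: integral_ge0 => x; rewrite /= in_itv/= andbT lee_fin => cx.
  by apply: phi0; exact: le_trans cx.
apply: le_lt_trans fin; apply: ge0_subset_integral.
- by apply: lebesgue_line_measurable; exact: measurable_itv.
- by apply: lebesgue_line_measurable; exact: measurable_itv.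
- exact/measurable_EFinP.
- by move=> x; rewrite /= in_itv/= andbT lee_fin; exact: phi0.
- by move=> x; rewrite /= !in_itv/= !andbT; exact: le_trans.
Qed.

(** The essential suprema of the [b i] over []s, s'[] serve as constant coefficients [beta i]. The
    resulting [D] depends on [s] and [s'] and is kept on both sides so that it can be divided
    out. *)
Lemma solution_decay_integral (R : realType) (m : nat) (hm : (1 < m)%N) (sigma a : R)
    (Q : R -> 'rV[R]_m -> R) (q : R -> R) (b : nat -> R -> R) (h w : R -> R) :
  let i0 := Ordinal (ltnW hm) in
  let f := f_fun m sigma a q b in
  1 < sigma -> 0 < a -> Linfty_loc a q -> (forall r, a <= r -> 0 <= q r) ->
  (forall i, (0 < i < m)%N ->
     Linfty_loc a (b i) /\ forall r, a <= r -> 0 <= b i r) ->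
  (forall (r : R) (t : 'rV[R]_m), a <= r -> 0 < t ord0 i0 ->
     (forall i : 'I_m, (0 < i)%N -> 0 <= (-1) ^+ i * t ord0 i) ->
     q r * h (t ord0 i0) - \sum_(i < m | (0 < i)%N) b i r * `|t ord0 i|
       <= (-1) ^+ m * Q r t) ->
  is_solution a Q w -> is_regular a w ->
  forall s s' H, a <= s -> s < s' -> s' <= sigma * s ->
    s' <= 2 * s -> 0 <= H -> (forall x, s <= x -> x <= s' -> H <= h (w x)) ->
  exists2 D, 1 <= D &
  (\int[leb]_(x in (`[s, s'] : set (lebesgue_line R)))
    (D * f x * H * ((x - s) ^+ m.-1 / (m.-1)`!%:R))%:E <= (D * (w s - w s'))%:E)%E.
Proof.
move=> i0 f s1 a0 Lq q0 hb hQ solw regw s s' H as_ ss' s's s'2 H0 hH.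
have sgt0 : 0 < s by lra.
have mon := solution_nonincreasing hm solw.
pose beta i := if (0 < i < m)%N then fine (ess_sup_on `]s, s'[ (b i)) else 0.
have bs i r : (0 < i < m)%N -> `]s, s'[%classic r -> 0 <= b i r.
  by move=> /hb[_ b0]; rewrite /= in_itv/= => /andP[sr _]; apply: b0; lra.
have beta0 i : 0 <= beta i.
  rewrite /beta; have [im|//] := boolP (0 < i < m)%N.
  by apply: (fine_ess_sup_on_ge0 ss') => // r; exact: bs.
pose D := 1 + \sum_(1 <= i < m) beta i * (s' - s) ^+ (m - i).
have D1 : 1 <= D.
  by rewrite lerDl sumr_ge0// => i _; rewrite mulr_ge0// exprn_ge0// subr_ge0 ltW.
have f0 x : a <= x -> 0 <= f x by move=> ax; exact: f_fun_ge0.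
have Dq x : s < x -> x < s' -> D * f x <= q x.
  move=> sx xs'; have ax : a <= x by lra.
  have den1 : 1 <= f_den m sigma a b x by exact: f_den_ge1.
  have den0 : 0 < f_den m sigma a b x by lra.
  have -> : q x = f_den m sigma a b x * f x by rewrite mulrC /f /f_fun divfK// gt_eqF.
  apply: ler_wpM2r; first exact: f0.
  apply: le_trans (f_den_ge s1 a0 as_ s's s'2 sx xs' hb).
  by rewrite lerD2l; apply: ler_sum_nat => i im; rewrite /beta im.
pose u := signed_deriv a w.
have mE : m.-1.+1 = m by rewrite prednK// ltnW.
have [dw acw eqw sw] := solw.
have betaP : \forall x \ae (@completed_lebesgue_measure R), forall i, (0 < i < m)%N ->
    `]s, s'[%classic x -> b i x <= beta i.
  apply: ae_foralln => i.
  have [im|nim] := boolP (0 < i < m)%N; last first.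
    by apply: (@leb_aeS _ (fun=> True)) => //; exact: aeW.
  have : \forall x \ae leb, `]s, s'[%classic x -> b i x <= fine (ess_sup_on `]s, s'[ (b i)).
    apply: ae_le_ess_sup_on; have [Lb b0] := hb _ im.
    apply: (@ess_sup_on_fin_num _ a _ _ s s' s s') => //; first by move=> r; exact: bs.
    by move=> y /=; rewrite !in_itv/= => /andP[/ltW-> /ltW->].
  by apply: leb_aeS => x hx _ /hx; rewrite /beta im.
pose N : set R := ~` [set x | (forall i, (0 < i < m)%N -> `]s, s'[%classic x -> b i x <= beta i) /\
  (a <= x -> derivable_from a (deriven_from a m.-1 w) x /\
        deriven_from a m w x = Q x (\row_(i < m) deriven_from a i w x))].
have negN : leb.-negligible (N : set (lebesgue_line R)).
  have := negligibleU betaP eqw; apply: negligibleS => x; rewrite /N /=.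
  by move=> /not_andP.
pose phi x := D * f x * H.
exists D => //.
have := @decay_integral_le R m.-1 u s s' beta phi N (ltW ss').
rewrite mE /u signed_deriv0; apply => //.
- move=> j jm; apply: abs_continuousM; first exact: abs_continuous_cst.
  by apply: acw => //; rewrite -mE.
- by move=> j x jm sx xs'; apply: sw; [rewrite -mE|lra].
- by apply: mon => //; exact: ltW.
- by move=> x sx xs'; rewrite /phi mulr_ge0// mulr_ge0 ?f0//; lra.
move=> x sx xs' /contrapT[bx /(_ _)[|dx eqx]]; first lra.
have ax : a < x by lra.
(* The formula also covers the top index [m - 1]; there [signed_deriv a w m] is [(-1)^m Q] by the
   equation, and the lower bound on [Q] gives the required inequality. *)
exists (fun j => - signed_deriv a w j.+1 x); split; [|by []|].
  move=> j; rewrite leq_eqVlt => /predU1P[->|jm]; first exact: is_derive_signed_deriv.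
  by apply: is_derive_signed_deriv => //; apply: dw; [rewrite -mE ltnS|exact: ltW].
rewrite mE /signed_deriv eqx.
set t := \row_(i < m) _.
have ti (i : 'I_m) : t ord0 i = deriven_from a i w x by rewrite mxE.
have wx : 0 < w x by apply: regular_solution_gt0 hm solw regw _ (ltW ax).
have := hQ x t (ltW ax); rewrite ti/= => /(_ wx) {}hQ.
have {}hQ : q x * h (w x) - \sum_(i < m | (0 < i)%N) b i x * `|t ord0 i| <= (-1) ^+ m * Q x t.
  by apply: hQ => i _; rewrite ti; apply: sw => //; exact: ltW.
have qh : phi x <= q x * h (w x).
  rewrite /phi; apply: ler_pM => //; first by apply: mulr_ge0; [lra|exact: f0 (ltW ax)].
    exact: Dq.
  by apply: hH; exact: ltW.
have sumE : \sum_(i < m | (0 < i)%N) b i x * `|t ord0 i| <=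
    \sum_(1 <= i < m) beta i * ((-1) ^+ i * deriven_from a i w x).
  under eq_bigr do rewrite ti.
  rewrite -(@big_mkord _ _ _ m (fun i => 0 < i)%N (fun i => b i x * `|deriven_from a i w x|)).
  rewrite big_mkcond big_ltn ?(ltnW hm)//= add0r; apply: ler_sum_nat => i im.
  have /andP[i_gt0 im'] := im; rewrite i_gt0.
  have di := sw i x im' (ltW ax).
  have -> : `|deriven_from a i w x| = (-1) ^+ i * deriven_from a i w x.
    by rewrite -[RHS]ger0_norm// normrM normrX normrN1 expr1n mul1r.
  by apply: ler_wpM2r => //; apply: bx; rewrite //= in_itv/= sx.
lra.
Qed.

Lemma solution_decay (R : realType) (m : nat) (hm : (1 < m)%N) (sigma a : R)
    (Q : R -> 'rV[R]_m -> R) (q : R -> R) (b : nat -> R -> R) (h w : R -> R) :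
  let i0 := Ordinal (ltnW hm) in
  let f := f_fun m sigma a q b in
  1 < sigma -> 0 < a -> Linfty_loc a q -> (forall r, a <= r -> 0 <= q r) ->
  (forall i, (0 < i < m)%N ->
     Linfty_loc a (b i) /\ forall r, a <= r -> 0 <= b i r) ->
  (forall x, 0 < x -> 0 < h x) ->
  (forall (r : R) (t : 'rV[R]_m), a <= r -> 0 < t ord0 i0 ->
     (forall i : 'I_m, (0 < i)%N -> 0 <= (-1) ^+ i * t ord0 i) ->
     q r * h (t ord0 i0) - \sum_(i < m | (0 < i)%N) b i r * `|t ord0 i|
       <= (-1) ^+ m * Q r t) ->
  (tail m f a < +oo)%E ->
  is_solution a Q w -> is_regular a w ->
  forall s eta s' H, a <= s -> 0 <= eta -> s + eta <= s' -> s' <= sigma * s ->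
    s' <= 2 * s -> 0 <= H -> (forall x, s <= x -> x <= s' -> H <= h (w x)) ->
  H / (m.-1)`!%:R * (eta / (2 * s)) ^+ m.-1 *
    (fine (tail m f (s + eta)) - fine (tail m f s')) <= w s - w s'.
Proof.
move=> i0 f s1 a0 Lq q0 hb h0 hQ Tfin solw regw s eta s' H as_ eta0 ses' s's s'2 H0 hH.
have sgt0 : 0 < s by lra.
have [ss'|s's0] := ltP s s'; last first.
  (* In the degenerate case the interval []s, s'[] is empty and its essential suprema are
     meaningless, so it is settled directly: [eta = 0] kills the left-hand side because
     [m - 1 > 0]. *)
  have -> : eta = 0 by lra.
  have -> : s' = s by lra.
  rewrite mul0r expr0n; have -> : (m.-1 == 0)%N = false by rewrite gtn_eqF// -ltnS prednK// ltnW.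
  by rewrite mulr0 mul0r subrr.
have f0 x : a <= x -> 0 <= f x by move=> ax; exact: f_fun_ge0.
have [D D1 key] := solution_decay_integral s1 a0 Lq q0 hb hQ solw regw as_ ss' s's s'2 H0 hH.
pose phi x := D * f x * H.
pose F x := x ^+ m.-1 * f x.
have F0 x : a <= x -> 0 <= F x by move=> ax; rewrite mulr_ge0 ?f0// exprn_ge0//; lra.
have mf : lebesgue_measurable_fun `[a, +oo[ f by exact: measurable_f_fun.
have mF := measurable_tail_integrand m.-1 mf.
have as1 : a <= s + eta by lra.
have as' : a <= s' by lra.
have := ge0_integral_tail_split mF F0 as1 ses'.
have T1 : tail m f (s + eta) \is a fin_num := tail_fin_num mF F0 as1 Tfin.
have T2 : tail m f s' \is a fin_num := tail_fin_num mF F0 as' Tfin.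
rewrite -/(tail m f (s + eta)) -/(tail m f s').
set I := (X in (_ = X + _)%E) => TE.
have fI : I \is a fin_num by move: T1; rewrite TE fin_numD => /andP[].
have -> : fine (tail m f (s + eta)) - fine (tail m f s') = fine I.
  by rewrite TE fineD//; ring.
set K := H / _ * _.
have K0 : 0 <= K.
  rewrite /K mulr_ge0// ?divr_ge0// exprn_ge0// divr_ge0//; lra.
have m1 : measurable (`[s + eta, s'[ : set (lebesgue_line R)).
  by apply: lebesgue_line_measurable; exact: measurable_itv.
have m2 : measurable (`[s, s'] : set (lebesgue_line R)).
  by apply: lebesgue_line_measurable; exact: measurable_itv.
have s1' x : `[s + eta, s'[%classic x -> a <= x /\ s + eta <= x < s'.
  by rewrite /= in_itv/= => /andP[? ?]; split; [lra|apply/andP].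
have mG : measurable_fun (`[s, s'] : set (lebesgue_line R))
    (fun x => phi x * ((x - s) ^+ m.-1 / (m.-1)`!%:R)).
  have mfs : measurable_fun (`[s, s'] : set (lebesgue_line R)) f.
    apply: measurable_funS mf; first by apply: lebesgue_line_measurable; exact: measurable_itv.
    by move=> x /=; rewrite !in_itv/= andbT => /andP[? _]; lra.
  apply: measurable_funM.
    apply: measurable_funM; last exact: measurable_cst.
    by apply: measurable_funM => //; exact: measurable_cst.
  apply: measurable_funM; last exact: measurable_cst.
  apply: measurable_funX; apply: measurable_funB; last exact: measurable_cst.
  move=> _ Y mY; apply: lebesgue_line_measurable; exact: measurableI.
have G0 x : s <= x -> 0 <= phi x * ((x - s) ^+ m.-1 / (m.-1)`!%:R).
  move=> sx; rewrite mulr_ge0 ?divr_ge0// ?exprn_ge0 ?subr_ge0//.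
  by rewrite /phi mulr_ge0// mulr_ge0 ?f0//; lra.
have sub : `[s + eta, s'[ `<=` `[s, s'].
  by move=> x /s1'[_ /andP[? ?]]; rewrite /= in_itv/=; apply/andP; split; lra.
have : ((D * K)%:E * I <= (D * (w s - w s'))%:E)%E.
  apply: le_trans key.
  have le2 : (\int[leb]_(x in (`[(s + eta)%R, s'[ : set (lebesgue_line R)))
      (phi x * ((x - s) ^+ m.-1 / (m.-1)`!%:R))%:E <=
      \int[leb]_(x in (`[s, s'] : set (lebesgue_line R)))
      (phi x * ((x - s) ^+ m.-1 / (m.-1)`!%:R))%:E)%E.
    apply: ge0_subset_integral; [exact: m1|exact: m2| | |exact: sub]; first exact/measurable_EFinP.
    by move=> x; rewrite /= in_itv/= => /andP[sx _]; rewrite lee_fin; exact: G0.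
  apply: le_trans le2.
  have mF' : measurable_fun (`[s + eta, s'[ : set (lebesgue_line R)) (EFin \o F).
    apply/measurable_EFinP; apply: measurable_funS mF; first by apply: lebesgue_line_measurable; exact: measurable_itv.
    by move=> x /s1'[ax _]; rewrite /= in_itv/= andbT.
  have DK0 : 0 <= D * K by rewrite mulr_ge0//; lra.
  rewrite /I -ge0_integralZl_EFin//; last by move=> x /s1'[ax _]; rewrite lee_fin; exact: F0.
  apply: ge0_le_integral; [exact: m1| | | |].
  - by move=> x /s1'[ax _]; rewrite -EFinM lee_fin mulr_ge0//; exact: F0.
  - exact: (measurable_funeM (D * K)%:E mF').
  - by apply/measurable_EFinP; exact: measurable_funS mG.
  move=> x /s1'[ax /andP[sx xs']]; rewrite -EFinM lee_fin /phi /F /K.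
  rewrite [leLHS](_ : _ = D * f x * H * ((eta / (2 * s)) ^+ m.-1 * x ^+ m.-1 / (m.-1)`!%:R)); last by ring.
  apply: ler_wpM2l; first by rewrite mulr_ge0// mulr_ge0 ?f0//; lra.
  rewrite ler_pM2r ?invr_gt0 ?ltr0n ?fact_gt0// -exprMn lerXn2r ?nnegrE; [by []| |lra|].
    by rewrite mulr_ge0 ?divr_ge0//; lra.
  (* What remains is [eta * x <= (x - s) * (2 * s)], from [eta <= x - s] and [x <= s' <= 2 * s]. *)
  rewrite mulrAC ler_pdivrMr; last lra.
  by apply: ler_pM; lra.
rewrite -(fineK fI) -EFinM lee_fin -mulrA ler_pM2l//; lra.
Qed.

(** * From decay inequalities to the power [1/m] of the tail *)

Lemma exprn_unbounded (R : realType) (k M : R) : 1 < k -> exists n : nat, M <= k ^+ n.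
Proof.
(* Bernoulli's inequality. *)
move=> k1; have H n : 1 + n%:R * (k - 1) <= k ^+ n.
  elim: n => [|n IH]; first by rewrite mul0r addr0.
  have : (1 + n%:R * (k - 1)) * k <= k ^+ n * k by rewrite ler_pM2r//; lra.
  rewrite exprSr; apply: le_trans; rewrite -natr1 -subr_ge0.
  have -> : (1 + n%:R * (k - 1)) * k - (1 + (n%:R + 1) * (k - 1)) = n%:R * (k - 1) ^+ 2 by ring.
  by rewrite mulr_ge0// sqr_ge0.
have k10 : 0 < k - 1 by lra.
exists (Num.truncn (M / (k - 1))).+1; apply: le_trans (H _).
have := truncnS_gt (M / (k - 1)); rewrite ltr_pdivrMr//; lra.
Qed.

Lemma subX_le (R : realType) (x y : R) n : 0 <= y -> y <= x ->
  (x - y) * x ^+ n <= x ^+ n.+1 - y ^+ n.+1.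
Proof.
move=> y0 yx; rewrite mulrBl -exprS lerD2l lerN2 exprS ler_wpM2l// lerXn2r ?nnegrE//.
exact: le_trans yx.
Qed.

Lemma powR_invnK (R : realType) (x : R) n : (0 < n)%N -> 0 <= x ->
  (x `^ n%:R^-1) ^+ n = x.
Proof.
move=> n0 x0; rewrite -powR_mulrn ?powR_ge0// -powRrM mulVf ?powRr1//.
by rewrite pnatr_eq0 -lt0n.
Qed.

(** Starting from [s / k] with [eta = s - s / k], the quotient [eta / (2 * (s / k))] is the constant
    [(k - 1) / 2], so [T s - T (s * k)] is controlled by [w (s / k) - w (s * k)]. Along the points
    [s * k ^ j] these two-step drops overlap, each drop of [w] being counted at most twice; hence
    the two leading terms on the right. *)
Lemma chain_decay (R : realType) (w T : R -> R) (n : nat) (k A rho rho' : R) :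
  1 < k -> 0 < rho ->
  (forall x y, rho <= x -> x <= y -> w y <= w x) ->
  (forall s eta s', rho <= s -> 0 <= eta -> s + eta <= s' -> s' <= k * k * s -> s' <= rho' ->
     A * (eta / (2 * s)) ^+ n * (T (s + eta) - T s') <= w s - w s') ->
  forall N s, rho <= s / k -> s <= rho' -> rho' <= s * k ^+ N ->
    A * ((k - 1) / 2) ^+ n * (T s - T rho') <= w (s / k) + w s - 2 * w rho'.
Proof.
move=> k1 rho0 wmon core; have k0 : 0 < k by lra.
have core' s s' : rho <= s / k -> s <= s' -> s' <= s * k -> s' <= rho' ->
    A * ((k - 1) / 2) ^+ n * (T s - T s') <= w (s / k) - w s'.
  move=> sk ss' s'k s'rho; have s0 : 0 < s by move: (lt_le_trans rho0 sk); rewrite pmulr_lgt0 ?invr_gt0.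
  have skle : s / k <= s by rewrite ler_pdivrMr// ler_peMr//; lra.
  have := core (s / k) (s - s / k) s'; rewrite (_ : s / k + (s - s / k) = s); last by ring.
  have -> : (s - s / k) / (2 * (s / k)) = (k - 1) / 2 by field; rewrite !gt_eqF.
  have -> : k * k * (s / k) = s * k by field; rewrite gt_eqF.
  by apply => //; lra.
elim=> [|N IH] s sk srho rhos.
  have -> : s = rho' by move: rhos; rewrite expr0 mulr1 => h; lra.
  have s0 : 0 < s by move: (lt_le_trans rho0 sk); rewrite pmulr_lgt0 ?invr_gt0.
  have skle : s / k <= s by rewrite ler_pdivrMr// ler_peMr//; lra.
  have -> : rho' = s by move: rhos; rewrite expr0 mulr1 => h; lra.
  by have := wmon _ _ sk skle; rewrite subrr mulr0; lra.
have s0 : 0 < s by move: (lt_le_trans rho0 sk); rewrite pmulr_lgt0 ?invr_gt0.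
have rhos' : rho <= s by apply: le_trans sk _; rewrite ler_pdivrMr// ler_peMr//; lra.
have [krho|rhok] := leP (s * k) rho'.
  have ssk : s <= s * k by rewrite ler_peMr//; lra.
  have := core' s (s * k) sk ssk (lexx _) krho.
  have := IH (s * k); rewrite mulfK ?gt_eqF// => /(_ rhos' krho).
  rewrite -mulrA -exprS => /(_ rhos).
  set B := A * _.
  have -> : B * (T s - T rho') = B * (T s - T (s * k)) + B * (T (s * k) - T rho') by ring.
  lra.
have := core' s rho' sk srho (ltW rhok) (lexx _); have := wmon _ _ rhos' srho; lra.
Qed.

(** With [eta] proportional to [s (T s - T s') / T s], at least half of the drop of [T] occurs after
    [s + eta], and the core inequality yields [(T s - T s')^(n+1) / (T s)^n] up to constants. In
    terms of the roots [x], [y] of order [n + 1] this dominates [(x - y)^(n+1)], by [subX_le]. *)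
Lemma short_decay (R : realType) (w T : R -> R) (n : nat) (k A L s s' : R) :
  0 < s -> s <= s' -> s' <= k * k * s -> 0 < L -> 0 <= A ->
  (forall x y, s <= x -> x <= y -> T y <= T x) -> (forall x, s <= x -> 0 <= T x) ->
  w s' <= w s ->
  (forall eta, 0 <= eta -> s + eta <= s' -> T s - T (s + eta) <= eta * (L * T s / s)) ->
  (forall eta, 0 <= eta -> s + eta <= s' ->
     A * (eta / (2 * s)) ^+ n * (T (s + eta) - T s') <= w s - w s') ->
  A / (2 * (4 * L) ^+ n) * (T s `^ n.+1%:R^-1 - T s' `^ n.+1%:R^-1) ^+ n.+1 <= w s - w s'.
Proof.
move=> s0 ss' s's L0 A0 Tmon T0 ws lip core.
have Ts := T0 _ (lexx s); have Ts' := T0 _ ss'; have TT := Tmon _ _ (lexx s) ss'.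
have [TE|TN] := eqVneq (T s) (T s').
  by rewrite TE subrr expr0n/= mulr0 subr_ge0.
have D0 : 0 < T s - T s' by rewrite subr_gt0 lt_neqAle eq_sym TN.
have Tp : 0 < T s by lra.
pose eta := s * (T s - T s') / (2 * L * T s).
have eta0 : 0 < eta by rewrite divr_gt0 ?mulr_gt0.
have etaE : eta * (L * T s / s) = (T s - T s') / 2.
  by rewrite /eta; field; rewrite !gt_eqF.
(* If [s + eta] exceeded [s'], the bound [lip] at [s' - s] would make the positive number
   [T s - T s'] at most half of itself. *)
have [ses'|s'se] := leP (s + eta) s'; last first.
  have : T s - T s' <= (s' - s) * (L * T s / s).
    by have := lip (s' - s); rewrite (_ : s + (s' - s) = s'); [apply; lra|ring].
  have : (s' - s) * (L * T s / s) <= eta * (L * T s / s).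
    by rewrite ler_wpM2r ?divr_ge0 ?mulr_ge0//; lra.
  rewrite etaE; lra.
have h1 := lip _ (ltW eta0) ses'; rewrite etaE in h1.
have := core _ (ltW eta0) ses'.
have -> : eta / (2 * s) = (T s - T s') / (4 * L * T s).
  by rewrite /eta; field; rewrite !gt_eqF.
apply: le_trans.
have h2 : (T s - T s') / 2 <= T (s + eta) - T s' by lra.
apply: (@le_trans _ _ (A * ((T s - T s') / (4 * L * T s)) ^+ n * ((T s - T s') / 2))); last first.
  apply: ler_wpM2l h2; apply: mulr_ge0 => //; apply/exprn_ge0/divr_ge0; first exact: ltW.
  by rewrite !mulr_ge0// ltW.
set x := T s `^ _; set y := T s' `^ _.
have xE : T s = x ^+ n.+1 by rewrite /x powR_invnK.
have yE : T s' = y ^+ n.+1 by rewrite /y powR_invnK.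
have x0 : 0 < x by rewrite /x powR_gt0.
have y0 : 0 <= y by rewrite /y powR_ge0.
have yx : y <= x by rewrite /x /y; apply: ge0_ler_powR; rewrite ?nnegrE ?invr_ge0.
have [L4 xn] : (4 * L) ^+ n != 0 /\ x ^+ n.+1 ^+ n != 0.
  by rewrite !expf_neq0 ?gt_eqF// mulr_gt0.
have -> : A * ((T s - T s') / (4 * L * T s)) ^+ n * ((T s - T s') / 2) =
    A / (2 * (4 * L) ^+ n) * ((T s - T s') ^+ n.+1 / (T s) ^+ n).
  rewrite expr_div_n exprMn exprSr xE; by field; apply/andP; split.
rewrite ler_wpM2l// ?divr_ge0 ?mulr_ge0 ?exprn_ge0 ?mulr_ge0 ?(ltW L0)//.
rewrite ler_pdivlMr ?exprn_gt0// xE yE -exprM mulnC exprM -exprMn.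
apply: lerXn2r; rewrite ?nnegrE.
- by rewrite mulr_ge0 ?subr_ge0// exprn_ge0 ?ltW.
- by rewrite -xE -yE ltW.
exact: subX_le.
Qed.

(* Here [rho'] need not be close to [rho]: the decay on [rho, rho * k] is
   estimated through the doubling bound on [T], the rest by summing the core
   inequality along the geometric sequence [rho * k ^ j]. *)
Lemma decay_powR (R : realType) (w T : R -> R) (n : nat) (k A L rho rho' : R) :
  1 < k -> 0 < rho -> rho <= rho' -> 0 < L -> 0 <= A ->
  (forall x y, rho <= x -> x <= y -> T y <= T x) -> (forall x, rho <= x -> 0 <= T x) ->
  (forall x y, rho <= x -> x <= y -> w y <= w x) -> 0 <= w rho' ->
  (forall eta, 0 <= eta -> T rho - T (rho + eta) <= eta * (L * T rho / rho)) ->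
  (forall s eta s', rho <= s -> 0 <= eta -> s + eta <= s' -> s' <= k * k * s -> s' <= rho' ->
     A * (eta / (2 * s)) ^+ n * (T (s + eta) - T s') <= w s - w s') ->
  A * Num.min (1 / (2 * (4 * L) ^+ n)) (((k - 1) / 2) ^+ n / 2) *
    ((T rho `^ n.+1%:R^-1 - T rho' `^ n.+1%:R^-1) / 2) ^+ n.+1 <= w rho.
Proof.
move=> k1 rho0 rr L0 A0 Tmon T0 wmon w0 lip core.
(* The first entry is the constant of [short_decay]; the second is that of [chain_decay], halved
   because the chain is bounded by [w rho + w (rho * k)], hence by [2 * w rho]. *)
set c := Num.min _ _; set p := n.+1%:R^-1.
have [c1 c2] : c <= 1 / (2 * (4 * L) ^+ n) /\ c <= ((k - 1) / 2) ^+ n / 2.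
  by rewrite !ge_min !lexx orbT.
have c0 : 0 <= c.
  rewrite le_min; apply/andP; split.
    by rewrite divr_ge0// mulr_ge0// exprn_ge0// mulr_ge0// ltW.
  by rewrite divr_ge0// exprn_ge0// divr_ge0// subr_ge0 ltW.
have p0 : 0 <= p by rewrite invr_ge0.
have Tp x y : rho <= x -> x <= y -> T y `^ p <= T x `^ p.
  by move=> rx xy; apply: ge0_ler_powR; rewrite ?nnegrE ?T0 ?Tmon//; exact: le_trans xy.
have short s' : rho <= s' -> s' <= rho * k -> s' <= rho' ->
    A * c * (T rho `^ p - T s' `^ p) ^+ n.+1 <= w rho.
  move=> rs srk srho.
  have rk : rho * k <= k * k * rho by rewrite mulrC -mulrA ler_peMl ?mulr_ge0//; lra.
  have := @short_decay R w T n k A L rho s' rho0 rs (le_trans srk rk) L0 A0 Tmon T0.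
  move=> /(_ (wmon _ _ (lexx _) rs)) H.
  have {}H : A / (2 * (4 * L) ^+ n) * (T rho `^ p - T s' `^ p) ^+ n.+1 <= w rho - w s'.
    apply: H => eta eta0 es; first exact: lip.
    by apply: core => //; exact: le_trans srk rk.
  have ws' : 0 <= w s' by apply: le_trans w0 (wmon _ _ rs srho).
  apply: (@le_trans _ _ (w rho - w s')); last lra.
  apply: le_trans H; rewrite ler_wpM2r ?exprn_ge0 ?subr_ge0 ?Tp//.
  by rewrite -[leRHS]mulr1 -mulrA [_^-1 * 1]mulrC ler_wpM2l.
have [rk|kr] := leP rho' (rho * k).
  apply: le_trans (short _ rr rk (lexx _)).
  rewrite ler_wpM2l ?mulr_ge0//; have := Tp _ _ (lexx _) rr => ?.
  by apply: lerXn2r; rewrite ?nnegrE; lra.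
have rrk : rho <= rho * k by rewrite ler_peMr//; lra.
have x1 := short (rho * k) rrk (lexx _) (ltW kr).
have [N hN] := exprn_unbounded (rho' / rho) k1.
have := @chain_decay R w T n k A rho rho' k1 rho0 wmon core N (rho * k).
rewrite mulfK ?gt_eqF//; last lra.
move=> /(_ (lexx _) (ltW kr)) H.
have {}H : A * ((k - 1) / 2) ^+ n * (T (rho * k) - T rho') <= w rho + w (rho * k) - 2 * w rho'.
  apply: H; apply: (@le_trans _ _ (rho * k ^+ N)); first by rewrite mulrC -ler_pdivrMr.
  rewrite -mulrA ler_wpM2l ?ler_peMl ?exprn_ge0//; lra.
have wk : w (rho * k) <= w rho by exact: wmon.
set X := T rho `^ p; set Y := T (rho * k) `^ p; set Z := T rho' `^ p.
have XY : Y <= X by exact: Tp.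
have YZ : Z <= Y by apply: Tp => //; exact: ltW.
have x2 : A * c * (Y - Z) ^+ n.+1 <= w rho.
  apply: (@le_trans _ _ (A * (((k - 1) / 2) ^+ n / 2) * (T (rho * k) - T rho'))); last first.
    rewrite mulrA mulrAC ler_pdivrMr//; lra.
  apply: ler_pM; [by rewrite mulr_ge0|by rewrite exprn_ge0// subr_ge0|by rewrite ler_wpM2l|].
  have -> : T (rho * k) = Y ^+ n.+1 by rewrite /Y powR_invnK// T0.
  have -> : T rho' = Z ^+ n.+1 by rewrite /Z powR_invnK// T0.
  have Z0 : 0 <= Z by exact: powR_ge0.
  apply: le_trans (subX_le n Z0 YZ); rewrite exprS ler_wpM2l ?subr_ge0//.
  by apply: lerXn2r; rewrite ?nnegrE ?subr_ge0//; lra.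
(* The larger of [X - Y] and [Y - Z] is at least [(X - Z) / 2]; this is the division by 2 in the
   conclusion. *)
have [XZ|ZX] := leP (X - Y) (Y - Z).
  apply: le_trans x2; rewrite ler_wpM2l ?mulr_ge0//; apply: lerXn2r; rewrite ?nnegrE; lra.
apply: le_trans x1; rewrite ler_wpM2l ?mulr_ge0//; apply: lerXn2r; rewrite ?nnegrE -/X -/Y; lra.
Qed.

(** * The functions [g] and [G_infty] *)

Lemma g_fun_le (R : realType) (theta : R) (h : R -> R) (t x : R) :
  (forall x, 0 < x -> 0 < h x) -> 1 < theta -> 0 < t ->
  t / theta < x -> x < theta * t -> g_fun theta h t <= h x.
Proof.
move=> h0 th1 t0 tx xt; apply: ge_inf; last by exists x => //=; rewrite in_itv/= tx.
exists 0 => _ [y /= + <-]; rewrite in_itv/= => /andP[ty _]; apply: ltW; apply: h0.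
by apply: lt_trans ty; rewrite divr_gt0//; lra.
Qed.

Lemma g_fun_ge (R : realType) (theta : R) (h : R -> R) (t z : R) :
  1 < theta -> 0 < t ->
  (forall x, t / theta < x -> x < theta * t -> z <= h x) -> z <= g_fun theta h t.
Proof.
move=> th1 t0 hz; apply: lb_le_inf.
  exists (h t); exists t => //=; rewrite in_itv/= ltr_pdivrMr ?ltr_pMr ?ltr_pMl ?th1//.
  by lra.
by move=> _ [y /= + <-]; rewrite in_itv/= => /andP[ty yt]; exact: hz.
Qed.

Lemma within_itv_sub (R : realType) (h : R -> R) (c d : R) : 0 < c ->
  {within `]0, +oo[, continuous h} -> {within `[c, d], continuous h}.
Proof.
move=> c0; apply: continuous_subspaceW => x /=.
by rewrite !in_itv/= andbT => /andP[cx _]; lra.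
Qed.

Lemma g_fun_lower_bound (R : realType) (theta : R) (h : R -> R) (c d : R) :
  1 < theta -> 0 < c -> c <= d -> {within `]0, +oo[, continuous h} ->
  (forall x, 0 < x -> 0 < h x) ->
  exists2 z, 0 < z & forall t, c <= t -> t <= d -> z <= g_fun theta h t.
Proof.
move=> th1 c0 cd ch h0; have th0 : 0 < theta by lra.
have cth : 0 < c / theta by rewrite divr_gt0.
have le : c / theta <= theta * d.
  apply: (@le_trans _ _ c); first by rewrite ler_pdivrMr// ler_peMr//; lra.
  by apply: (le_trans cd); rewrite ler_peMl//; lra.
have [y yI hy] := EVT_min le (within_itv_sub cth ch).
exists (h y).
  by apply: h0; move: yI; rewrite in_itv/= => /andP[? _]; lra.
move=> t ct td; apply: g_fun_ge => // [|x tx xt]; first lra.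
apply: hy; rewrite in_itv/=; apply/andP; split.
  by apply: le_trans (ltW tx); rewrite ler_pM2r ?invr_gt0.
by apply: le_trans (ltW xt) _; rewrite ler_pM2l.
Qed.

(** The function is upper semicontinuous: [x] lies in the window of [t] exactly when [t] lies in []x
    / theta, x * theta[], so a strict sublevel set is a union of such open intervals. *)
Lemma measurable_g_fun (R : realType) (theta : R) (h : R -> R) :
  1 < theta -> (forall x, 0 < x -> 0 < h x) ->
  measurable_fun (`]0, +oo[ : set R) (g_fun theta h).
Proof.
move=> th1 h0 m0; have th0 : 0 < theta by lra.
apply: (measurability _ (RGenInftyO.measurableE R)) => // _ [_ [y ->] <-].
pose O := \bigcup_(x in [set x | h x < y]) `]x / theta, x * theta[%classic.
have oO : open O by apply: bigcup_open => x _; exact: itv_open.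
have -> : `]0, +oo[ `&` g_fun theta h @^-1` `]-oo, y[ = `]0, +oo[ `&` O :> set R.
  apply/seteqP; split => t /= [+ yt]; rewrite in_itv/= andbT => t0; split => //.
    move: yt; rewrite in_itv/= => yt; apply: contrapT => nO.
    move: yt; rewrite ltNge => /negP; apply; apply: g_fun_ge => // x tx xt.
    rewrite leNgt; apply/negP => hxy; apply: nO; exists x => //=.
    rewrite in_itv/=; apply/andP; split; first by rewrite ltr_pdivrMr// mulrC.
    by rewrite -ltr_pdivrMr.
  move: yt => [x /= hxy]; rewrite !in_itv/= => /andP[xt tx].
  apply: le_lt_trans hxy; apply: g_fun_le => //.
    by rewrite ltr_pdivrMr.
  by rewrite mulrC -ltr_pdivrMr.
apply: measurableI => //; exact: open_measurable.
Qed.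

Lemma measurable_G_integrand (R : realType) (m : nat) (theta : R) (h : R -> R) :
  1 < theta -> (forall x, 0 < x -> 0 < h x) ->
  lebesgue_measurable_fun `]0, +oo[ (G_integrand m (g_fun theta h)).
Proof.
move=> th1 h0.
have mG : measurable_fun (`]0, +oo[ : set R) (G_integrand m (g_fun theta h)).
  apply: measurable_funM.
    exact: (measurableT_comp (@measurable_powR R _) (measurable_g_fun th1 h0)).
  apply: (@measurable_funS _ _ _ _ setT) => //; exact: measurable_powR.
by move=> _ Y mY; apply: lebesgue_line_measurable; apply: mG.
Qed.

Lemma G_integrand_ge0 (R : realType) (m : nat) (g : R -> R) (t : R) :
  0 <= G_integrand m g t.
Proof. by rewrite mulr_ge0// powR_ge0. Qed.

Lemma nonpos_powR_le (R : realType) (p x y : R) : p <= 0 -> 0 < x -> x <= y ->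
  y `^ p <= x `^ p.
Proof.
move=> p0 x0 xy; have y0 : 0 < y by lra.
rewrite -[p]opprK !(powRN _ (- p)) lef_pV2 ?posrE ?powR_gt0//.
by apply: ge0_ler_powR; rewrite ?nnegrE ?oppr_ge0//; lra.
Qed.

Lemma G_integrand_bounds (R : realType) (m : nat) (g : R -> R) (y z t c d : R) :
  (0 < m)%N -> 0 < c -> c <= t -> t <= d -> 0 < y -> y <= g t -> g t <= z ->
  z `^ (- m%:R^-1) * d `^ (m%:R^-1 - 1) <= G_integrand m g t <=
  y `^ (- m%:R^-1) * c `^ (m%:R^-1 - 1).
Proof.
move=> m0 c0 ct td y0 yg gz.
have p1 : - m%:R^-1 <= 0 :> R by rewrite oppr_le0 invr_ge0.
have p2 : m%:R^-1 - 1 <= 0 :> R by rewrite subr_le0 invf_le1 ?ler1n ?ltr0n.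
by apply/andP; split; apply: ler_pM; rewrite ?powR_ge0//; apply: nonpos_powR_le => //; lra.
Qed.

Lemma integral_itv_bounds (R : realType) (c d y z : R) (phi : R -> R) :
  c <= d -> 0 <= y ->
  measurable_fun (`[c, d[ : set (lebesgue_line R)) phi ->
  (forall x, c <= x -> x < d -> y <= phi x <= z) ->
  ((y * (d - c))%:E <= \int[leb]_(x in (`[c, d[ : set (lebesgue_line R))) (phi x)%:E
     <= (z * (d - c))%:E)%E.
Proof.
move=> cd y0 mphi hphi.
have mcd : measurable (`[c, d[ : set (lebesgue_line R)).
  by apply: lebesgue_line_measurable; exact: measurable_itv.
have icst k : (\int[leb]_(x in (`[c, d[ : set (lebesgue_line R))) (cst k%:E x))%E = (k * (d - c))%:E.
  rewrite integral_cst; last exact: mcd.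
  transitivity (k%:E * lebesgue_measure `[c, d[)%E; first by [].
  rewrite lebesgue_measure_itv/= lte_fin; case: ltP => // dc.
  by have -> : d = c; [lra|rewrite subrr mulr0 mule0].
have bnd x : `[c, d[%classic x -> y <= phi x <= z.
  by rewrite /= in_itv/= => /andP[]; exact: hphi.
have mc (k : R) : measurable_fun (`[c, d[ : set (lebesgue_line R)) (cst k%:E) by exact: measurable_cst.
have mp := (measurable_EFinP _ _).2 mphi.
rewrite -!icst; apply/andP; split.
  apply: ge0_le_integral; [exact: mcd| |exact: mc|exact: mp|] => x; first by rewrite lee_fin.
  by move=> /bnd/andP[]; rewrite lee_fin.
apply: ge0_le_integral; [exact: mcd| |exact: mp|exact: mc|] => x /bnd/andP[yx xz].
  by rewrite lee_fin; exact: le_trans yx.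
by rewrite lee_fin.
Qed.

Lemma G_infty0 (R : realType) (m : nat) (g : R -> R) : G_infty m g 0 = 0.
Proof.
have E : `]0, 0[%classic = set0 :> set R.
  by apply/seteqP; split => // x /=; rewrite in_itv/= => /andP[/lt_trans h /h]; rewrite ltxx.
by rewrite /G_infty E integral_set0.
Qed.

Lemma G_integrand_itv_bounds (R : realType) (m : nat) (theta : R) (h : R -> R) (y z c d : R) :
  (0 < m)%N -> 1 < theta -> (forall x, 0 < x -> 0 < h x) ->
  0 < c -> c <= d -> 0 < y -> (forall t, c <= t -> t <= d -> y <= g_fun theta h t <= z) ->
  ((z `^ (- m%:R^-1) * d `^ (m%:R^-1 - 1) * (d - c))%:E <=
    \int[leb]_(x in (`[c, d[ : set (lebesgue_line R))) (G_integrand m (g_fun theta h) x)%:E <=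
   (y `^ (- m%:R^-1) * c `^ (m%:R^-1 - 1) * (d - c))%:E)%E.
Proof.
move=> m0 th1 h0 c0 cd y0 hg; apply: integral_itv_bounds => //.
- by rewrite mulr_ge0 ?powR_ge0.
- apply: measurable_funS (measurable_G_integrand m th1 h0).
    by apply: lebesgue_line_measurable; exact: measurable_itv.
  by move=> x; rewrite /= !in_itv/= andbT => /andP[cx _]; lra.
- move=> x cx xd; have /andP[h1 h2] := hg x cx (ltW xd).
  by apply: G_integrand_bounds => //; exact: ltW.
Qed.

Lemma G_integral_split (R : realType) (m : nat) (theta : R) (h : R -> R) (c d : R) :
  1 < theta -> (forall x, 0 < x -> 0 < h x) -> 0 < c -> c <= d ->
  (\int[leb]_(x in (`]0%R, d[ : set (lebesgue_line R))) (G_integrand m (g_fun theta h) x)%:E =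
   \int[leb]_(x in (`]0%R, c[ : set (lebesgue_line R))) (G_integrand m (g_fun theta h) x)%:E +
   \int[leb]_(x in (`[c, d[ : set (lebesgue_line R))) (G_integrand m (g_fun theta h) x)%:E)%E.
Proof.
move=> th1 h0 c0 cd.
have -> : `]0, d[%classic = `]0, c[ `|` `[c, d[ :> set R.
  apply/seteqP; split => x /=; rewrite !in_itv/=.
    by move=> /andP[x0 xd]; case: (ltP x c) => xc; [left; rewrite x0|right].
  by case=> /andP[? ?]; apply/andP; split; lra.
apply: ge0_integral_setU.
- by apply: lebesgue_line_measurable; exact: measurable_itv.
- by apply: lebesgue_line_measurable; exact: measurable_itv.
- apply/measurable_EFinP; apply: measurable_funS (measurable_G_integrand m th1 h0).
    by apply: lebesgue_line_measurable; exact: measurable_itv.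
  by move=> x /= [|]; rewrite !in_itv/= andbT => /andP[? ?]; lra.
- by move=> x _; rewrite lee_fin G_integrand_ge0.
- rewrite disj_set2E; apply/eqP/seteqP; split => // x [] /=; rewrite !in_itv/=.
  by move=> /andP[_ xc] /andP[cx _]; move: cx; rewrite leNgt xc.
Qed.

Lemma G_integral_fin (R : realType) (m : nat) (theta : R) (h : R -> R) (X : R) :
  (0 < m)%N -> 1 < theta -> {within `]0, +oo[, continuous h} -> (forall x, 0 < x -> 0 < h x) ->
  (\int[leb]_(t in `]0%R, 1%R[) (G_integrand m (g_fun theta h) t)%:E < +oo)%E ->
  (\int[leb]_(t in (`]0%R, X[ : set (lebesgue_line R))) (G_integrand m (g_fun theta h) t)%:E)%E \is a fin_num.
Proof.
move=> m0 th1 ch h0 fin1; rewrite ge0_fin_numE; last first.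
  by apply: integral_ge0 => x _; rewrite lee_fin G_integrand_ge0.
have [X1|X1] := leP X 1.
  apply: le_lt_trans fin1; apply: ge0_subset_integral.
  - by apply: lebesgue_line_measurable; exact: measurable_itv.
  - by apply: lebesgue_line_measurable; exact: measurable_itv.
  - apply/measurable_EFinP; apply: measurable_funS (measurable_G_integrand m th1 h0).
      by apply: lebesgue_line_measurable; exact: measurable_itv.
    by move=> x; rewrite /= !in_itv/= andbT => /andP[].
  - by move=> x _; rewrite lee_fin G_integrand_ge0.
  - by move=> x; rewrite /= !in_itv/= => /andP[-> ?]; lra.
rewrite (G_integral_split m th1 h0 ltr01 (ltW X1)); apply: lte_add_pinfty => //.
have [y y0 hy] := g_fun_lower_bound th1 ltr01 (ltW X1) ch h0.
have mcd : measurable_fun (`[1, X[ : set (lebesgue_line R)) (G_integrand m (g_fun theta h)).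
  apply: measurable_funS (measurable_G_integrand m th1 h0).
    by apply: lebesgue_line_measurable; exact: measurable_itv.
  by move=> x; rewrite /= !in_itv/= andbT => /andP[cx _]; lra.
have := @integral_itv_bounds R 1 X 0 (y `^ (- m%:R^-1) * 1 `^ (m%:R^-1 - 1))
  _ (ltW X1) (lexx _) mcd.
case/(_ _)/andP => [x x1 xX|_ /le_lt_trans]; last by apply; rewrite ltry.
rewrite G_integrand_ge0/=.
have := @G_integrand_bounds R m (g_fun theta h) y (g_fun theta h x) x 1 X m0 ltr01 x1 (ltW xX) y0.
by case/(_ _ _)/andP => //; exact: hy x1 (ltW xX).
Qed.

Lemma G_infty_ge0 (R : realType) (m : nat) (g : R -> R) (x : R) : 0 <= G_infty m g x.
Proof.
by apply: fine_ge0; apply: integral_ge0 => t _; rewrite lee_fin G_integrand_ge0.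
Qed.

Lemma G_inftyB_bounds (R : realType) (m : nat) (theta : R) (h : R -> R) (y z c d : R) :
  (0 < m)%N -> 1 < theta -> {within `]0, +oo[, continuous h} -> (forall x, 0 < x -> 0 < h x) ->
  (\int[leb]_(t in `]0%R, 1%R[) (G_integrand m (g_fun theta h) t)%:E < +oo)%E ->
  0 < c -> c <= d -> 0 < y -> (forall t, c <= t -> t <= d -> y <= g_fun theta h t <= z) ->
  z `^ (- m%:R^-1) * d `^ (m%:R^-1 - 1) * (d - c) <=
    G_infty m (g_fun theta h) d - G_infty m (g_fun theta h) c <=
  y `^ (- m%:R^-1) * c `^ (m%:R^-1 - 1) * (d - c).
Proof.
move=> m0 th1 ch h0 fin1 c0 cd y0 hg.
have := G_integrand_itv_bounds m0 th1 h0 c0 cd y0 hg.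
have := G_integral_fin d m0 th1 ch h0 fin1.
rewrite /G_infty (G_integral_split m th1 h0 c0 cd) fin_numD => /andP[fc fcd].
rewrite fineD// addrAC subrr add0r -(fineK fcd) !lee_fin.
by rewrite fineK.
Qed.

(** Continuity at 0 cannot come from the Lipschitz bounds, whose constants depend on the distance to
    0. It follows from monotone convergence along [[1/(n+1), 1[]. *)
Lemma G_infty_small (R : realType) (m : nat) (theta : R) (h : R -> R) (e : R) :
  (0 < m)%N -> 1 < theta -> {within `]0, +oo[, continuous h} -> (forall x, 0 < x -> 0 < h x) ->
  (\int[leb]_(t in `]0%R, 1%R[) (G_integrand m (g_fun theta h) t)%:E < +oo)%E ->
  0 < e -> exists2 c, 0 < c & G_infty m (g_fun theta h) c <= e.
Proof.
move=> m0 th1 ch h0 fin1 e0; set g := g_fun theta h.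
pose F n : set (lebesgue_line R) := `[n.+1%:R^-1, 1[%classic.
have FU : \bigcup_n F n = `]0, 1[%classic.
  apply/seteqP; split => x.
    move=> [n _]; rewrite /F/= !in_itv/= => /andP[nx ->]; rewrite andbT.
    by apply: lt_le_trans nx; rewrite invr_gt0.
  rewrite /= in_itv/= => /andP[x0 x1]; exists (Num.truncn x^-1) => //.
  by rewrite /F/= in_itv/= x1 andbT ltW// invf_plt ?posrE// truncnS_gt.
have mF i : measurable (F i) by apply: lebesgue_line_measurable; exact: measurable_itv.
have ndF : nondecreasing_seq F.
  move=> i j ij; rewrite subsetEset => x; rewrite /F/= !in_itv/= => /andP[ix ->]; rewrite andbT.
  by apply: le_trans ix; rewrite lef_pV2 ?posrE// ler_nat.
have mGF i : measurable_fun (F i) (EFin \o G_integrand m g).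
  apply/measurable_EFinP; apply: measurable_funS (measurable_G_integrand m th1 h0).
    by apply: lebesgue_line_measurable; exact: measurable_itv.
  move=> x; rewrite /F/= !in_itv/= => /andP[ix _]; rewrite andbT.
  by apply: lt_le_trans ix; rewrite invr_gt0.
have GF i x : F i x -> (0 <= (EFin \o G_integrand m g) x)%E.
  by move=> _; rewrite lee_fin G_integrand_ge0.
have := @ge0_nondecreasing_set_cvg_integral _ _ R F (EFin \o G_integrand m g) leb ndF mF mGF GF.
have fin1' := G_integral_fin 1 m0 th1 ch h0 fin1.
rewrite FU -(fineK fin1') => /fine_cvgP[_ /cvgrPdist_le/(_ _ e0)[n _ /(_ n (leqnn n))]] /=.
have n0 : 0 < n.+1%:R^-1 :> R by rewrite invr_gt0.
have n1 : n.+1%:R^-1 <= 1 :> R by rewrite invf_le1 ?ler1n ?ltr0n.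
have := G_integral_split m th1 h0 n0 n1.
rewrite -/g -/(F n); set A := (\int[_]_(_ in F n) _)%E => E.
have A0 : (0 <= A)%E by apply: integral_ge0 => x _; rewrite lee_fin G_integrand_ge0.
move: fin1'; rewrite -/g E fin_numD => /andP[fc fA].
rewrite fineD// addrK => h1; exists n.+1%:R^-1 => //.
by apply: le_trans h1; rewrite ler_norm.
Qed.

Lemma powR_exprn_inv (R : realType) (x : R) n : (0 < n)%N -> 0 <= x ->
  (x ^+ n) `^ n%:R^-1 = x.
Proof.
move=> n0 x0; rewrite -powR_mulrn// -powRrM mulfV ?powRr1//.
by rewrite pnatr_eq0 -lt0n.
Qed.

Lemma g_fun_upper_bound (R : realType) (theta : R) (h : R -> R) (c d : R) :
  1 < theta -> 0 < c -> c <= d -> {within `]0, +oo[, continuous h} ->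
  (forall x, 0 < x -> 0 < h x) ->
  exists2 z, 0 < z & forall t, c <= t -> t <= d -> g_fun theta h t <= z.
Proof.
move=> th1 c0 cd ch h0; have th0 : 0 < theta by lra.
have [y yI hy] := EVT_max cd (within_itv_sub c0 ch).
exists (h y); first by apply: h0; move: yI; rewrite in_itv/= => /andP[? _]; lra.
move=> t ct td; have t0 : 0 < t by lra.
apply: (@le_trans _ _ (h t)); last by apply: hy; rewrite in_itv/= ct.
apply: g_fun_le => //; first by rewrite ltr_pdivrMr// ltr_pMr.
by rewrite ltr_pMl.
Qed.

Lemma G_infty_lt (R : realType) (m : nat) (theta : R) (h : R -> R) (c d : R) :
  (0 < m)%N -> 1 < theta -> {within `]0, +oo[, continuous h} -> (forall x, 0 < x -> 0 < h x) ->
  (\int[leb]_(t in `]0%R, 1%R[) (G_integrand m (g_fun theta h) t)%:E < +oo)%E ->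
  0 <= c -> c < d -> G_infty m (g_fun theta h) c < G_infty m (g_fun theta h) d.
Proof.
move=> m0 th1 ch h0 fin1.
have pos x y : 0 < x -> x < y -> G_infty m (g_fun theta h) x < G_infty m (g_fun theta h) y.
  move=> x0 xy.
  have [z z0 hz] := g_fun_upper_bound th1 x0 (ltW xy) ch h0.
  have [z' z'0 hz'] := g_fun_lower_bound th1 x0 (ltW xy) ch h0.
  have := @G_inftyB_bounds R m theta h z' z x y m0 th1 ch h0 fin1 x0 (ltW xy) z'0.
  case/(_ _)/andP => [t xt ty|h1 _]; first by rewrite hz ?hz'.
  rewrite -subr_gt0; apply: lt_le_trans h1.
  by rewrite !mulr_gt0 ?powR_gt0 ?subr_gt0//; lra.
rewrite le_eqVlt => /predU1P[<-|c0]; last exact: pos.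
move=> d0; rewrite G_infty0; apply: le_lt_trans (pos (d / 2) d _ _); [exact: G_infty_ge0|lra|lra].
Qed.

Lemma G_infty_abs_continuous (R : realType) (m : nat) (theta : R) (h : R -> R) (c d : R) :
  (0 < m)%N -> 1 < theta -> {within `]0, +oo[, continuous h} -> (forall x, 0 < x -> 0 < h x) ->
  (\int[leb]_(t in `]0%R, 1%R[) (G_integrand m (g_fun theta h) t)%:E < +oo)%E ->
  0 < c -> c <= d -> abs_continuous c d (G_infty m (g_fun theta h)).
Proof.
move=> m0 th1 ch h0 fin1 c0 cd.
have [z z0 hz] := g_fun_upper_bound th1 c0 cd ch h0.
have [z' z'0 hz'] := g_fun_lower_bound th1 c0 cd ch h0.
apply: (@lipschitz_abs_continuous _ _ _ (z' `^ (- m%:R^-1) * c `^ (m%:R^-1 - 1))) => x y cx xy yd.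
have x0 : 0 < x by lra.
have := @G_inftyB_bounds R m theta h z' z x y m0 th1 ch h0 fin1 x0 xy z'0.
case/(_ _)/andP => [t xt ty|h1 h2].
  have ct : c <= t by lra.
  have td : t <= d by lra.
  by rewrite hz ?hz'.
rewrite ger0_norm; last first.
  by apply: le_trans h1; rewrite !mulr_ge0 ?powR_ge0// subr_ge0.
apply: le_trans h2 _; rewrite ler_wpM2r ?subr_ge0// ler_wpM2l ?powR_ge0//.
by apply: nonpos_powR_le => //; rewrite subr_le0 invf_le1 ?ler1n ?ltr0n.
Qed.

(** Outside the range of [G_infty] the inverse takes the default value 0 and the inequality would
    say nothing, so membership in the range is proved along with it. *)
Lemma G_infty_inv_le (R : realType) (m : nat) (theta : R) (h : R -> R) (x y : R) :
  (0 < m)%N -> 1 < theta -> {within `]0, +oo[, continuous h} -> (forall x, 0 < x -> 0 < h x) ->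
  (\int[leb]_(t in `]0%R, 1%R[) (G_integrand m (g_fun theta h) t)%:E < +oo)%E ->
  0 < x -> 0 <= y -> y <= G_infty m (g_fun theta h) x ->
  (G_infty m (g_fun theta h) @` `[0, +oo[) y /\ G_infty_inv m (g_fun theta h) y <= x.
Proof.
move=> m0 th1 ch h0 fin1 x0 y0 yG.
set G := G_infty m (g_fun theta h).
have Gmon u v : 0 <= u -> u < v -> G u < G v by move=> *; exact: G_infty_lt.
have Gle u v : 0 <= u -> u <= v -> G u <= G v.
  by move=> u0; rewrite le_eqVlt => /predU1P[->//|uv]; apply: ltW; exact: Gmon.
have [xi [xi0 xix Gxi]] : exists xi, [/\ 0 <= xi, xi <= x & G xi = y].
  move: y0; rewrite le_eqVlt => /predU1P[<-|y0].
    by exists 0; split; [|exact: ltW|exact: G_infty0].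
  have [c c0 Gc] := G_infty_small m0 th1 ch h0 fin1 y0.
  (* The intermediate value theorem is applied on [[c, x]], away from 0. If [x < c], then
     [G x <= G c <= y <= G x], and [x] itself is the preimage. *)
  have [cx|xc] := leP c x; last first.
    exists x; split => //; first exact: ltW.
    by apply/le_anti; rewrite yG andbT; apply: le_trans Gc; apply: Gle; exact: ltW.
  have cG := abs_continuous_within (G_infty_abs_continuous m0 th1 ch h0 fin1 c0 cx).
  have [|xi] := @IVT R G c x y cx cG.
    by rewrite ge_min le_max Gc yG orbT.
  by rewrite in_itv/= => /andP[cxi xix] Gxi; exists xi; split => //; lra.
split; first by exists xi => //=; rewrite in_itv/= andbT.
rewrite -Gxi /G_infty_inv pinvKV ?inE//=; last by rewrite in_itv/= andbT.
move=> u v; rewrite !inE/= !in_itv/= !andbT => u0 v0 Guv.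
by case: (ltgtP u v) => // [/(Gmon _ _ u0)|/(Gmon _ _ v0)]; rewrite /G Guv ltxx.
Qed.

(* On [b / sqrt theta, b] the function [g] is at most the minimum of [h] there. *)
Lemma G_infty_step (R : realType) (m : nat) (theta k X b : R) (h : R -> R) :
  (0 < m)%N -> 1 < theta -> {within `]0, +oo[, continuous h} -> (forall x, 0 < x -> 0 < h x) ->
  (\int[leb]_(t in `]0%R, 1%R[) (G_integrand m (g_fun theta h) t)%:E < +oo)%E ->
  0 < b -> 0 <= k -> 0 <= X ->
  (forall H, 0 <= H -> (forall x, b / Num.sqrt theta <= x -> x <= b -> H <= h x) ->
    H * k * (X / 2) ^+ m <= b) ->
  (1 - (Num.sqrt theta)^-1) * (k `^ m%:R^-1 / 2) * X <=
    G_infty m (g_fun theta h) b - G_infty m (g_fun theta h) (b / Num.sqrt theta).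
Proof.
move=> m0 th1 ch h0 fin1 b0 k0 X0 hX; set th := Num.sqrt theta.
have th0 : 0 < theta by lra.
have thE : theta = th * th by rewrite -expr2 sqr_sqrtr// ltW.
have sth1 : 1 < th by rewrite -sqrtr1 ltr_sqrt.
have sth0 : 0 < th by lra.
have c0 : 0 < b / th by rewrite divr_gt0.
have cb : b / th <= b by rewrite ler_pdivrMr// ler_peMr//; lra.
have [y yI hy] := EVT_min cb (within_itv_sub c0 ch).
move: yI; rewrite in_itv/= => /andP[cy yb].
have y0 : 0 < y by lra.
set H := h y; have H0 : 0 < H by exact: h0.
(* Both [t] and the minimiser [y] lie in [[b / th, b]], so their ratio is at most [th]; as
   [th < th * th = theta], the point [y] belongs to the open window that defines [g] at [t]. *)
have gH t : b / th <= t -> t <= b -> g_fun theta h t <= H.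
  move=> ct tb; have t0 : 0 < t by lra.
  apply: g_fun_le => //.
    apply: (@lt_le_trans _ _ (t / th)).
      by rewrite ltr_pM2l// ltf_pV2 ?posrE// thE ltr_pMr.
    by apply: le_trans cy; rewrite ler_pM2r// invr_gt0.
  apply: (@lt_le_trans _ _ (th * (th * t))); last by rewrite thE mulrA.
  apply: (@le_lt_trans _ _ (th * t)); last by rewrite ltr_pMl// mulr_gt0.
  by apply: (le_trans yb); rewrite mulrC -ler_pdivrMr.
have [z z0 hz] := g_fun_lower_bound th1 c0 cb ch h0.
have := @G_inftyB_bounds R m theta h z H _ _ m0 th1 ch h0 fin1 c0 cb z0.
case/(_ _)/andP => [t ct tb|h1 _]; first by rewrite hz ?gH.
apply: le_trans h1; set p := m%:R^-1.
have p0 : 0 < p by rewrite invr_gt0 ltr0n.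
(* The lower bound of the integrand times the length [b - b / th]; the factor [1 - 1 / sqrt theta]
   of the final constant comes from here. *)
have -> : H `^ (- p) * b `^ (p - 1) * (b - b / th) = (1 - th^-1) * (b / H) `^ p.
  rewrite powRM ?invr_ge0 ?ltW// powRN -[H^-1]powR_inv1 ?(ltW H0)// -powRrM mulN1r powRN.
  have -> : b `^ p = b `^ (p - 1) * b.
    by rewrite -[X in _ * X]powRr1 ?(ltW b0)// -powRD ?subrK// (gt_eqF b0) implybT.
  by field; rewrite ?gt_eqF ?powR_gt0.
rewrite -mulrA ler_wpM2l//; first by rewrite subr_ge0 invf_le1// ltW.
have : k * (X / 2) ^+ m <= b / H.
  rewrite ler_pdivlMr//; have := hX H (ltW H0).
  rewrite (_ : k * (X / 2) ^+ m * H = H * k * (X / 2) ^+ m); last by ring.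
  by apply => x cx xb; apply: hy; rewrite in_itv/= cx.
move=> /(@ge0_ler_powR R p (ltW p0)); rewrite !nnegrE.
have -> : (k * (X / 2) ^+ m) `^ p = k `^ p / 2 * X.
  rewrite /p powRM ?exprn_ge0 ?divr_ge0// powR_exprn_inv ?divr_ge0//.
  by field.
apply; first by rewrite mulr_ge0 ?exprn_ge0 ?divr_ge0.
exact: divr_ge0 (ltW b0) (ltW H0).
Qed.

(** * Chaining the stretches and the final estimate *)

(** By the intermediate value theorem a complete stretch ends where [w] has dropped by exactly the
    factor [th], so the differences of [G] telescope. The induction is on [N] with
    [w rho <= th ^ N * w rho'], and such an [N] exists because [w rho'] is positive. *)
Lemma G_infty_iter (R : realType) (r0 th C : R) (w Tp G : R -> R) :
  1 < th -> (forall x, r0 <= x -> 0 < w x) -> (forall c d, r0 <= c -> {within `[c, d], continuous w}) ->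
  (forall x, 0 <= G x) ->
  (forall rho rho', r0 <= rho -> rho <= rho' -> w rho / th <= w rho' ->
     C * (Tp rho - Tp rho') <= G (w rho) - G (w rho / th)) ->
  forall rho rho', r0 <= rho -> rho <= rho' -> C * (Tp rho - Tp rho') <= G (w rho).
Proof.
move=> th1 w0 cw G0 step rho rho' r0rho rr; have th0 : 0 < th by lra.
have [N hN] := exprn_unbounded (w rho / w rho') th1.
have w'0 : 0 < w rho' by apply: w0; exact: le_trans rr.
move: hN; rewrite ler_pdivrMr//.
elim: N rho r0rho rr => [|N IH] rho r0rho rr hN; last first.
  have [ws|ws] := leP (w rho / th) (w rho').
    by apply: le_trans (step _ _ r0rho rr ws) _; rewrite gerBl.
  have wr : w rho / th <= w rho by rewrite ler_pdivrMr// ler_peMr ?ltW// w0.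
  have [|s] := @IVT R w rho rho' (w rho / th) rr (cw _ _ r0rho).
    by rewrite ge_min le_max (ltW ws) wr/= orbT.
  rewrite in_itv/= => /andP[rs srho] wsE.
  have h1 : C * (Tp rho - Tp s) <= G (w rho) - G (w rho / th).
    by apply: step => //; rewrite wsE.
  have h2 : C * (Tp s - Tp rho') <= G (w s).
    apply: IH => //; first exact: le_trans rs.
    by rewrite wsE ler_pdivrMr// mulrAC -exprSr.
  rewrite wsE in h2.
  have -> : C * (Tp rho - Tp rho') = C * (Tp rho - Tp s) + C * (Tp s - Tp rho') by ring.
  lra.
rewrite expr0 mul1r in hN.
apply: le_trans (step _ _ r0rho rr _) _; last by rewrite gerBl.
by apply: (le_trans _ hN); rewrite ler_pdivrMr// ler_peMr ?ltW// w0.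
Qed.

Lemma limsup_quotient_eventually (R : realType) (m : nat) (f : R -> R) (L M : R) :
  limsup_quotient m f = L%:E -> L < M ->
  exists r0, forall r, r0 < r -> r ^+ m * f r / fine (tail m f r) <= M.
Proof.
move=> hL LM; have : (limsup_quotient m f < M%:E)%E by rewrite hL lte_fin.
case/ereal_inf_lt => _ [V [r0 [_ hV]] <-] VM; exists r0 => r rr0.
rewrite -lee_fin; apply: le_trans (ltW VM).
by apply: ereal_sup_ubound; exists r => //; exact: hV.
Qed.

Lemma tail_nonincreasing (R : realType) (m : nat) (a x y : R) (f : R -> R) :
  0 < a -> lebesgue_measurable_fun `[a, +oo[ f -> (forall x, a <= x -> 0 <= f x) ->
  (tail m f a < +oo)%E -> a <= x -> x <= y -> fine (tail m f y) <= fine (tail m f x).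
Proof.
move=> a0 mf f0 Tfin ax xy.
have F0 t : a <= t -> 0 <= t ^+ m.-1 * f t.
  by move=> at_; rewrite mulr_ge0 ?f0// exprn_ge0//; lra.
have mF := measurable_tail_integrand m.-1 mf.
apply: fine_le; [exact: tail_fin_num mF F0 (le_trans ax xy) Tfin|exact: tail_fin_num mF F0 ax Tfin|].
rewrite /tail (ge0_integral_tail_split mF F0 ax xy) leeDr//.
by apply: integral_ge0 => t; rewrite /= in_itv/= lee_fin => /andP[xt _]; apply: F0; lra.
Qed.

(** For [t >= x] the quotient bound reads [t^(m-1) f t <= M T(t) / t], with [T] the tail, and this
    is at most [M T(x) / x]; integrate over [[x, x + eta[]. *)
Lemma tail_increment_le (R : realType) (m : nat) (a M x eta : R) (f : R -> R) :
  (0 < m)%N -> 0 < a -> lebesgue_measurable_fun `[a, +oo[ f -> (forall x, a <= x -> 0 <= f x) ->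
  (tail m f a < +oo)%E -> a <= x -> 0 <= eta -> 0 <= M ->
  (forall r, x <= r -> 0 < fine (tail m f r)) ->
  (forall r, x <= r -> r ^+ m * f r / fine (tail m f r) <= M) ->
  fine (tail m f x) - fine (tail m f (x + eta)) <= eta * (M * fine (tail m f x) / x).
Proof.
move=> m0 a0 mf f0 Tfin ax eta0 M0 T0 hM.
have F0 t : a <= t -> 0 <= t ^+ m.-1 * f t.
  by move=> at_; rewrite mulr_ge0 ?f0// exprn_ge0//; lra.
have mF := measurable_tail_integrand m.-1 mf.
have x0 : 0 < x by lra.
have xe : x <= x + eta by lra.
have axe : a <= x + eta by lra.
have T1 : tail m f x \is a fin_num := tail_fin_num mF F0 ax Tfin.
have := ge0_integral_tail_split mF F0 ax xe.
rewrite -/(tail m f x) -/(tail m f (x + eta)); set I := (X in (_ = X + _)%E) => TE.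
have : (I <= (M * fine (tail m f x) / x * (x + eta - x))%:E)%E.
  have mF' : measurable_fun (`[x, x + eta[ : set (lebesgue_line R)) (fun t => t ^+ m.-1 * f t).
    apply: measurable_funS mF; first by apply: lebesgue_line_measurable; exact: measurable_itv.
    by move=> t; rewrite /= !in_itv/= andbT => /andP[xt _]; lra.
  have := @integral_itv_bounds R x (x + eta) 0 (M * fine (tail m f x) / x) _ xe (lexx _) mF'.
  case/(_ _)/andP => // t xt te; have at_ : a <= t by lra.
  have t0 : 0 < t by lra.
  rewrite F0//=; have := hM t xt; rewrite ler_pdivrMr ?T0// => h1.
  have h2 : M * fine (tail m f t) <= M * fine (tail m f x).
    by rewrite ler_wpM2l//; exact: tail_nonincreasing ax xt.
  rewrite ler_pdivlMr//; apply: le_trans h2; apply: le_trans h1.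
  have -> : t ^+ m = t ^+ m.-1 * t by rewrite -exprSr prednK.
  by rewrite [leRHS]mulrAC ler_wpM2l ?F0.
have [fI fT] : I \is a fin_num /\ tail m f (x + eta) \is a fin_num.
  by move: T1; rewrite TE fin_numD => /andP.
have -> : fine (tail m f x) - fine (tail m f (x + eta)) = fine I.
  by rewrite TE fineD//; ring.
rewrite -{1}(fineK fI) lee_fin (_ : x + eta - x = eta); last by ring.
by rewrite mulrC.
Qed.

Theorem theorem2p4 (R : realType) (m : nat) (hm : (1 < m)%N)
    (theta sigma L : R) (htheta : 1 < theta) (hsigma : 1 < sigma) :
  exists2 C : R, 0 < C &
    forall (a : R) (Q : R -> 'rV[R]_m -> R) (q : R -> R) (b : nat -> R -> R)
      (h : R -> R),
    let i0 := Ordinal (ltnW hm) in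
    let g := g_fun theta h in
    let f := f_fun m sigma a q b in
    0 < a ->
    Kloc a Q ->
    Linfty_loc a q ->
    (forall r, a <= r -> 0 <= q r) ->
    (forall i, (0 < i < m)%N ->
       Linfty_loc a (b i) /\ forall r, a <= r -> 0 <= b i r) ->
    {within `]0, +oo[, continuous h} ->
    (forall x, 0 < x -> 0 < h x) ->
    (forall (r : R) (t : 'rV[R]_m), a <= r -> 0 < t ord0 i0 ->
       (forall i : 'I_m, (0 < i)%N -> 0 <= (-1) ^+ i * t ord0 i) ->
       q r * h (t ord0 i0) - \sum_(i < m | (0 < i)%N) b i r * `|t ord0 i|
         <= (-1) ^+ m * Q r t) ->
    (\int[leb]_(t in `]0%R, 1%R[) (G_integrand m g t)%:E < +oo)%E ->
    (tail m f a < +oo)%E ->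
    limsup_quotient m f = L%:E ->
    forall w : R -> R, is_solution a Q w -> is_regular a w ->
    \forall r \near +oo,
      let y := C * fine (tail m f r) `^ m%:R^-1 in
      (G_infty m g @` `[0, +oo[) y /\ G_infty_inv m g y <= w r.

Proof.
have m0 : (0 < m)%N by exact: ltnW.
have mE : m.-1.+1 = m by rewrite prednK.
(* The choice [k * k = min(sigma, 2)] meets both length restrictions of [solution_decay], and [L']
   is positive and larger than [L]. Both are fixed before the data of the problem, as the dependence
   of [C] demands. *)
pose k := Num.sqrt (Num.min sigma 2); pose L' := `|L| + 1.
have min1 : 1 < Num.min sigma 2 by rewrite lt_min hsigma; lra.
have k1 : 1 < k by rewrite -sqrtr1 ltr_sqrt//; lra.
have kk : k * k = Num.min sigma 2 by rewrite -expr2 sqr_sqrtr//; lra.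
have [ks k2] : k * k <= sigma /\ k * k <= 2.
  by rewrite kk !ge_min !lexx orbT.
have L0 : 0 < L' by rewrite /L'; have := normr_ge0 L; lra.
pose c := Num.min (1 / (2 * (4 * L') ^+ m.-1)) (((k - 1) / 2) ^+ m.-1 / 2).
have c0 : 0 < c.
  rewrite lt_min; apply/andP; split.
    by rewrite divr_gt0// mulr_gt0// exprn_gt0// mulr_gt0.
  by rewrite divr_gt0// exprn_gt0// divr_gt0// subr_gt0.
have fact0 : 0 < (m.-1)`!%:R :> R by rewrite ltr0n fact_gt0.
pose k0 := c / (m.-1)`!%:R; have k00 : 0 < k0 by rewrite divr_gt0.
have sth1 : 1 < Num.sqrt theta by rewrite -sqrtr1 ltr_sqrt//; lra.
pose C := (1 - (Num.sqrt theta)^-1) * (k0 `^ m%:R^-1 / 2).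
have C0 : 0 < C.
  by rewrite mulr_gt0// ?subr_gt0 ?invf_lt1 ?divr_gt0 ?powR_gt0//; lra.
exists C => // a Q q b h i0 g f a0 KQ Lq q0 hb ch h0 hQ fin1 Tfin hL w solw regw.
have f0 x : a <= x -> 0 <= f x by move=> ax; exact: f_fun_ge0.
have mf : lebesgue_measurable_fun `[a, +oo[ f by exact: measurable_f_fun.
have F0 t : a <= t -> 0 <= t ^+ m.-1 * f t.
  by move=> at_; rewrite mulr_ge0 ?f0// exprn_ge0//; lra.
have mF := measurable_tail_integrand m.-1 mf.
pose T r := fine (tail m f r).
have T0 r : a <= r -> 0 <= T r.
  move=> ar; apply: fine_ge0; apply: integral_ge0 => t; rewrite /= in_itv/= andbT lee_fin => rt.
  by apply: F0; lra.
have wpos := regular_solution_gt0 hm solw regw.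
suff [r1 [ar1 hr1]] : exists r1, a <= r1 /\ forall r, r1 <= r ->
    C * T r `^ m%:R^-1 <= G_infty m g (w r).
  exists r1; split; [exact: num_real|move=> r /ltW r1r].
  apply: G_infty_inv_le => //; first by apply: wpos; exact: le_trans r1r.
    by rewrite mulr_ge0 ?powR_ge0// ltW.
  exact: hr1.
have Tmon x y : a <= x -> x <= y -> T y <= T x by move=> ax xy; exact: (tail_nonincreasing a0).
have p0 : 0 <= m%:R^-1 :> R by rewrite invr_ge0.
have pN0 : m%:R^-1 != 0 :> R by rewrite invr_eq0 pnatr_eq0 -lt0n.
(* Where the tail vanishes the quotient is a division by 0 and carries no information; but from [z]
   on the tail is 0 and so is the left-hand side. *)
have [[z [az Tz]]|Tpos] := pselect (exists z, a <= z /\ T z = 0).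
  exists z; split => // r zr.
  have -> : T r = 0 by apply/le_anti; rewrite T0 ?(le_trans az)// andbT -Tz Tmon.
  by rewrite powR0// mulr0 G_infty_ge0.
have {}Tpos r : a <= r -> 0 < T r.
  by move=> ar; rewrite lt_neqAle T0// andbT eq_sym; apply/eqP => Tr; apply: Tpos; exists r.
have LL' : L < L' by rewrite /L'; have := ler_norm L; lra.
have [r0 hr0] := limsup_quotient_eventually hL LL'.
(* The quotient bound holds only for arguments strictly beyond [r0], hence the [+ 1]. *)
pose r1 := Num.max a (r0 + 1).
have [ar1 rr1] : a <= r1 /\ r0 + 1 <= r1 by rewrite !le_max !lexx orbT.
exists r1; split => // rho r1rho.
have wmon := solution_nonincreasing hm solw.
have cw c' d : r1 <= c' -> {within `[c', d], continuous w}.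
  move=> rc; apply: abs_continuous_within; have [_ acw _ _] := solw.
  by apply: (acw 0%N m0); exact: le_trans rc.
have step s s' : r1 <= s -> s <= s' -> w s / Num.sqrt theta <= w s' ->
    C * (T s `^ m%:R^-1 - T s' `^ m%:R^-1) <=
    G_infty m g (w s) - G_infty m g (w s / Num.sqrt theta).
  move=> rs ss' ws; have as_ : a <= s by lra.
  apply: G_infty_step => //; [exact: wpos|exact: ltW| |].
    by rewrite subr_ge0; apply: ge0_ler_powR; rewrite ?nnegrE ?T0 ?(le_trans as_)//; exact: Tmon.
  move=> H H0 hH.
  have := @decay_powR R w T m.-1 k (H / (m.-1)`!%:R) L' s s' k1.
  have AE : H / (m.-1)`!%:R * c = H * k0 by rewrite /k0 mulrA mulrAC.
  rewrite mE -/c AE; apply => //.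
  - lra.
  - by rewrite divr_ge0// ltW.
  - by move=> x y sx; apply: Tmon; lra.
  - by move=> x sx; apply: T0; lra.
  - by move=> x y sx; apply: wmon; lra.
  - by apply: ltW; apply: wpos; lra.
  - move=> eta eta0; apply: (tail_increment_le m0 a0) => //; first exact: ltW.
      by move=> r sr; apply: Tpos; lra.
    by move=> r sr; apply: hr0; lra.
  move=> t eta t' st eta0 tt' t'k t's'; have t0 : 0 < t by lra.
  have at_ : a <= t by exact: le_trans st.
  have tsigma : t' <= sigma * t by apply: (le_trans t'k); rewrite ler_pM2r.
  have t2 : t' <= 2 * t by apply: (le_trans t'k); rewrite ler_pM2r.
  apply: (solution_decay hsigma a0 Lq q0 hb h0 hQ Tfin solw regw at_ eta0 tt' tsigma t2 H0).
  (* By monotonicity [w x] lies between [w s / sqrt theta] and [w s], the range on which [H] bounds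
     [h] from below. *)
  move=> x tx xt'; have ax : a <= x by exact: le_trans tx.
  by apply: hH; [apply: (le_trans ws); apply: wmon => //; exact: le_trans t's'
                |apply: wmon => //; exact: le_trans tx].
have iter := G_infty_iter sth1 _ cw (@G_infty_ge0 R m g) step.
(* The limit [s' -> oo]: the point [s'] is taken so far out that its tail is at most [e' ^ m], which
   makes the subtracted term at most [C * e' = e]. *)
apply/ler_addgt0Pr => e e0; pose e' := e / C.
have e'0 : 0 < e' by rewrite divr_gt0.
have [z az Tz] := ge0_integral_tail_cvg0 mF F0 Tfin (exprn_gt0 m e'0).
pose s' := Num.max z rho.
have [zs rs] : z <= s' /\ rho <= s' by rewrite !le_max !lexx orbT.
have := iter (fun x r1x => wpos x (le_trans ar1 r1x)) rho s' r1rho rs.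
have : T s' `^ m%:R^-1 <= e'.
  rewrite -[leRHS](@powR_exprn_inv R e' m) ?(ltW e'0)//.
  apply: ge0_ler_powR; rewrite ?nnegrE ?T0 ?exprn_ge0 ?(ltW e'0) ?(le_trans az)//.
  apply: (le_trans (Tmon _ _ az zs)); rewrite -lee_fin /T fineK//.
  exact: (tail_fin_num mF F0 az Tfin).
have Ce : C * e' = e by rewrite /e' mulrC divfK// gt_eqF.
move=> /(ler_wpM2l (ltW C0)); rewrite Ce => h1 h2.
by have := lerD h2 h1; rewrite mulrBr subrK.
Qed.
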